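(* Let $\ast\colon[0,\infty)^\ell_\infty\times[0,\infty)\to[0,\infty)^\ell_\infty$ be a contour and $N=N_\ast$ the simple norm on $\mathrm{tame}([0,\infty)^\ell,\mathrm{vec}_K)$ associated with $\ast$. Assume $K$ is a finite field, $D\subset[0,\infty)^\ell$ is a compact subset in the standard topology, and $m,n$ are positive integers. Let $\mathcal{T}(D,n,m)$ be the set of isomorphism classes of tame functors $X\colon[0,\infty)^\ell\to\mathrm{vec}_K$ such that $\mathrm{supp}(\beta_0X)\subset D$, $\mathrm{supp}(\beta_1X)\subset D$, $\sum\beta_0X\le n$ and $\sum\beta_1X\le m$. (1) If $\ast$ is continuous, then the set $\mathcal{T}(D,n,m)$, with the topology induced by the pseudo-metric $d_N$, is compact. (2) If $\ast$ is continuous and unital, then the set $\mathcal{T}(D,n,m)$, with the topology induced by the metric $d_N$, is compact, complete, and totally bounded.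
   Context: Functors. $[0,\infty)^\ell$ is the poset of $\ell$-tuples of non-negative reals with the coordinatewise order; $[0,\infty)^\ell_\infty$ is obtained by adding a global maximum $\infty$. $K$ is a field and $\mathrm{vec}_K$ is the category of finite dimensional $K$-vector spaces. For $v\in[0,\infty)^\ell$, $K(v,-)\colon[0,\infty)^\ell\to\mathrm{vec}_K$ is the functor with $K(v,x)=K$ if $v\le x$ and $0$ otherwise, with identity maps between nonzero values. A functor $X\colon[0,\infty)^\ell\to\mathrm{vec}_K$ is tame if it is finitely presented: there are finitely supported functions $\beta_0,\beta_1\colon[0,\infty)^\ell\to\mathbf{N}$ and an exact sequence (free presentation) $\bigoplus_vK(v,-)^{\beta_1(v)}\to\bigoplus_vK(v,-)^{\beta_0(v)}\to X\to0$. Among the free presentations of $X$ there are minimal ones; the functions for a minimal presentation are denoted $\beta_0X,\beta_1X$ (Betti diagrams), $\mathrm{supp}(\beta_iX)=\{v\mid\beta_iX(v)>0\}$, and $\sum\beta_iX=\sum_v\beta_iX(v)$. Tame functors form an Abelian category $\mathrm{tame}([0,\infty)^\ell,\mathrm{vec}_K)$. Contours. A contour in dimension $\ell$ is a function $\ast\colon[0,\infty)^\ell_\infty\times[0,\infty)\to[0,\infty)^\ell_\infty$ such that: (1) $v\le v\ast t$ for all $v,t$; (2) $v\ast s\le w\ast t$ whenever $v\le w$ and $s\le t$; (3) $(v\ast s)\ast t\le v\ast(s+t)$ for all $v,s,t$; (4) for all $v,w$, the set $\{t\in[0,\infty)\mid v\ast t\ge w\}$ is either empty or of the form $[a,\infty)$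 with $a\in[0,\infty)$. The contour is unital if $v\ast0=v$ for every $v\in[0,\infty)^\ell_\infty$. Distance. $N_\ast(X):=\inf\{t\in[0,\infty)\mid X(v\le v\ast t)=0\text{ for every }v\in[0,\infty)^\ell\text{ with }v\ast t<\infty\}$ for tame $X$ (with $\inf\emptyset=\infty$). For a morphism $f$ of tame functors, $N(f):=N(\ker f)+N(\mathrm{coker}f)$. $d_N(X,Y):=\inf\sum_iN(f_i)$, the infimum over all finite zig-zags $X=W_0\xrightarrow{f_1}W_1\xleftarrow{f_2}W_2\xrightarrow{f_3}\cdots\xleftarrow{f_l}W_l=Y$ of tame functors. This is a pseudo-metric with values in $[0,\infty]$, well defined on isomorphism classes; for unital $\ast$ it is an (extended) metric on isomorphism classes. Continuity. On $[0,\infty)^\ell$ let $d_N(v,w):=d_N(K(v,-),K(w,-))$ (the paper shows this equals $\delta(v,w)+\delta(w,v)$ with $\delta(v,w)=\inf\{t\in[0,\infty)\mid v\ast t\ge w\}$), and $d_\infty(v,w)=\max_i|v_i-w_i|$, which induces the standard topology. The contour $\ast$ is continuous if the identity function $([0,\infty)^\ell,d_\infty)\to([0,\infty)^\ell,d_N)$ is continuous. Compact means that every open cover has a finite sub-cover (no separation is assumed). *)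

(* Defs.v *)
From HB Require Import structures.
From mathcomp Require Import all_boot all_order all_algebra finmap.
From mathcomp Require Import generic_quotient.
From mathcomp Require Import all_classical all_reals all_analysis.

Set Implicit Arguments.
Unset Strict Implicit.
Unset Printing Implicit Defensive.

Import Order.TTheory GRing.Theory Num.Theory.
Import numFieldNormedType.Exports.

Local Open Scope classical_set_scope.
Local Open Scope ring_scope.
Local Open Scope quotient_scope.

(* A subtype of ['rV[R]_l], hence with the subspace (standard) topology.      *)
Definition orthant (R : realType) (l : nat) : Type :=
  set_type [set v : 'rV[R]_l | forall i, 0 <= v ord0 i].

HB.instance Definition _ (R : realType) (l : nat) :=
  PseudoMetric.copy (orthant R l)
    (set_type [set v : 'rV[R]_l | forall i, 0 <= v ord0 i]).

Definition pcoord (R : realType) (l : nat) (v : orthant R l) (i : 'I_l) : R :=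
  (set_val v : 'rV[R]_l) ord0 i.

Definition ple (R : realType) (l : nat) (v w : orthant R l) : bool :=
  [forall i, pcoord v i <= pcoord w i].

(* [None] is the added global maximum.                                        *)
Definition ple_oo (R : realType) (l : nat) (x y : option (orthant R l)) : bool :=
  match x, y with
  | _, None => true
  | None, Some _ => false
  | Some v, Some w => ple v w
  end.

Definition dist_oo (R : realType) (l : nat) (v w : orthant R l) : R :=
  \big[Num.max/0]_(i < l) `|pcoord v i - pcoord w i|.

Record contour (R : realType) (l : nat) := Contour {
  cshift :> option (orthant R l) -> {nonneg R} -> option (orthant R l);
  shift_ge : forall v t, ple_oo v (cshift v t);
  shift_mono : forall v w s t, ple_oo v w -> s%:num <= t%:num ->
    ple_oo (cshift v s) (cshift w t);
  shift_shift : forall v s t,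
    ple_oo (cshift (cshift v s) t) (cshift v (s%:num + t%:num)%:nng);
  shift_closed : forall v w,
    [set t | ple_oo w (cshift v t)] = set0 \/
    exists a : {nonneg R},
      [set t | ple_oo w (cshift v t)] = [set t : {nonneg R} | a%:num <= t%:num]
}.

Definition unital (R : realType) (l : nat) (c : contour R l) : Prop :=
  forall v, c v 0%:nng = v.

Record pfunctor (R : realType) (l : nat) (K : fieldType) := PFunctor {
  ob :> orthant R l -> vectType K;
  mor : forall v w, ple v w -> 'Hom(ob v, ob w);
  mor_id : forall v (h : ple v v), mor h = \1%VF;
  mor_comp : forall u v w (huv : ple u v) (hvw : ple v w) (huw : ple u w),
    mor huw = (mor hvw \o mor huv)%VF
}.
Arguments mor {R l K} p {v w}.
Arguments mor_comp {R l K} p {u v w}.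

Record nattrans (R : realType) (l : nat) (K : fieldType)
    (X Y : pfunctor R l K) := NatTrans {
  component :> forall v, 'Hom(X v, Y v);
  natural : forall v w (h : ple v w),
    (component w \o mor X h = mor Y h \o component v)%VF
}.

Definition is_iso (R : realType) (l : nat) (K : fieldType)
    (X Y : pfunctor R l K) (f : nattrans X Y) : Prop :=
  exists g : nattrans Y X, forall v,
    (g v \o f v = \1)%VF /\ (f v \o g v = \1)%VF.

Definition isomorphic (R : realType) (l : nat) (K : fieldType)
  (X Y : pfunctor R l K) : Prop := exists f : nattrans X Y, is_iso f.

Section Constructions.
Variables (R : realType) (l : nat) (K : fieldType).
Implicit Types (X Y : pfunctor R l K) (u v w x : orthant R l).

Lemma ple_refl v : ple v v.
Proof. by apply/forallP. Qed.

Lemma ple_trans v u w : ple u v -> ple v w -> ple u w.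
Proof.
move=> /forallP uv /forallP vw; apply/forallP => i.
exact: le_trans (uv i) (vw i).
Qed.

Section Identity.
Variable X : pfunctor R l K.
Fact nat_id_subproof v w (h : ple v w) :
  (\1 \o mor X h = mor X h \o \1)%VF.
Proof. by rewrite comp_lfun1l comp_lfun1r. Qed.
Definition nat_id : nattrans X X := NatTrans nat_id_subproof.
End Identity.

Section Composition.
Variables (X Y Z : pfunctor R l K) (g : nattrans Y Z) (f : nattrans X Y).
Fact nat_comp_subproof v w (h : ple v w) :
  ((g w \o f w) \o mor X h = mor Z h \o (g v \o f v))%VF.
Proof. by rewrite -comp_lfunA natural !comp_lfunA natural. Qed.
Definition nat_comp : nattrans X Z := NatTrans nat_comp_subproof.
End Composition.

Section Zero.
Let zob (v : orthant R l) : vectType K := 'rV[K]_0.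
Let zmor v w (_ : ple v w) : 'Hom(zob v, zob w) := \1%VF.
Fact zero_id v (h : ple v v) : zmor h = \1%VF. Proof. by []. Qed.
Fact zero_comp u v w (huv : ple u v) (hvw : ple v w) (huw : ple u w) :
  zmor huw = (zmor hvw \o zmor huv)%VF.
Proof. by rewrite comp_lfun1l. Qed.
Definition zero_functor : pfunctor R l K := PFunctor zero_id zero_comp.
End Zero.

(* K(v,-): the space of row vectors of length 1 if v <= x and 0 otherwise;    *)
(* multiplication by the all-ones matrix is the identity when both are 1.     *)
Section Representable.
Variable v : orthant R l.
Fact ord_bool_inj (b : bool) (i j : 'I_b) : i = j.
Proof.
case: b i j => [i j|[//]]; first by rewrite !ord1.
Qed.

Let rob x : vectType K := 'rV[K]_(ple v x).
Let rmor x y (_ : ple x y) : 'Hom(rob x, rob y) :=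
  linfun (mulmxr (const_mx 1 : 'M[K]_(ple v x, ple v y))).

Fact representable_id x (h : ple x x) : rmor h = \1%VF.
Proof.
apply/lfunP => a; rewrite lfunE /= id_lfunE; apply/rowP => i.
rewrite mxE (bigD1 i) //= mxE mulr1 big1 ?addr0 // => j /negP[]; apply/eqP.
exact: ord_bool_inj.
Qed.

Fact representable_comp x y z (hxy : ple x y) (hyz : ple y z) (hxz : ple x z) :
  rmor hxz = (rmor hyz \o rmor hxy)%VF.
Proof.
apply/lfunP => a; rewrite comp_lfunE !lfunE /= -mulmxA; congr (_ *m _).
apply/matrixP => i j; rewrite !mxE (eq_bigr (fun=> 1)) => [|k _]; last first.
  by rewrite !mxE mulr1.
have vx : ple v x by case: (boolP (ple v x)) (leq_ltn_trans (leq0n i) (ltn_ord i)).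
by rewrite sumr_const card_ord (ple_trans vx hxy).
Qed.

Definition representable : pfunctor R l K :=
  PFunctor representable_id representable_comp.
End Representable.

Section DirectSum.
Variables X Y : pfunctor R l K.
Let dob v : vectType K := (X v * Y v)%type.
Let dfun v w (h : ple v w) (p : dob v) : dob w := (mor X h p.1, mor Y h p.2).
Fact dsum_linear v w (h : ple v w) : linear (dfun h).
Proof.
by move=> a [x1 y1] [x2 y2]; rewrite /dfun /= !linearP.
Qed.
HB.instance Definition _ v w (h : ple v w) :=
  GRing.isLinear.Build K (dob v) (dob w) _ (dfun h) (dsum_linear h).
Let dmor v w (h : ple v w) : 'Hom(dob v, dob w) := linfun (dfun h).

Fact dsum_id v (h : ple v v) : dmor h = \1%VF.
Proof.
by apply/lfunP => -[x y]; rewrite lfunE /= /dfun /= !mor_id !id_lfunE.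
Qed.
Fact dsum_comp u v w (huv : ple u v) (hvw : ple v w) (huw : ple u w) :
  dmor huw = (dmor hvw \o dmor huv)%VF.
Proof.
apply/lfunP => -[x y]; rewrite comp_lfunE !lfunE /= /dfun /=.
by rewrite (mor_comp X huv hvw huw) (mor_comp Y huv hvw huw) !comp_lfunE.
Qed.
Definition dsum : pfunctor R l K := PFunctor dsum_id dsum_comp.
End DirectSum.

Section Kernel.
Variables (X Y : pfunctor R l K) (f : nattrans X Y).
Let kob v : vectType K := subvs_of (lker (f v)).
Let kmor v w (h : ple v w) : 'Hom(kob v, kob w) :=
  (linfun (@vsproj K (X w) (lker (f w))) \o mor X h \o
   linfun (@vsval K (X v) (lker (f v))))%VF.

Lemma ker_stable v w (h : ple v w) a :
  a \in lker (f v) -> mor X h a \in lker (f w).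
Proof.
rewrite !memv_ker -comp_lfunE natural comp_lfunE => /eqP ->.
by rewrite linear0.
Qed.

Lemma val_kmor v w (h : ple v w) (a : kob v) :
  vsval (kmor h a) = mor X h (vsval a).
Proof. by rewrite !comp_lfunE !lfunE /= vsprojK // ker_stable ?subvsP. Qed.

Fact ker_id v (h : ple v v) : kmor h = \1%VF.
Proof.
by apply/lfunP => a; apply/val_inj; rewrite [LHS]val_kmor mor_id !id_lfunE.
Qed.
Fact ker_comp u v w (huv : ple u v) (hvw : ple v w) (huw : ple u w) :
  kmor huw = (kmor hvw \o kmor huv)%VF.
Proof.
apply/lfunP => a; apply/val_inj.
by rewrite [LHS]val_kmor comp_lfunE [RHS]val_kmor val_kmor
  (mor_comp X huv hvw huw) comp_lfunE.
Qed.
Definition ker_functor : pfunctor R l K := PFunctor ker_id ker_comp.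

Lemma ker_mor0 : (forall v, lker (f v) = 0%VS) ->
  forall v w (h : ple v w), mor ker_functor h = 0.
Proof.
move=> f_inj v w h; apply/lfunP => a; rewrite zero_lfunE.
have /eqP a0 : vsval a == 0 by rewrite -memv0 -(f_inj v) subvsP.
have -> : a = 0 by exact: val_inj.
exact: linear0.
Qed.
End Kernel.

(* The quotient of [Y v] by the image of [f v] is realised on the complement  *)
(* [(limg (f v))^C], with quotient map [coker_pi v].                          *)
Section Cokernel.
Variables (X Y : pfunctor R l K) (f : nattrans X Y).
Let cob v : vectType K := subvs_of (limg (f v))^C.
Definition coker_pi v : 'Hom(Y v, cob v) :=
  (linfun (@vsproj K (Y v) (limg (f v))^C) \o (\1 - projv (limg (f v))))%VF.
Let cmor v w (h : ple v w) : 'Hom(cob v, cob w) :=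
  (coker_pi w \o mor Y h \o linfun (@vsval K (Y v) (limg (f v))^C))%VF.

Lemma val_coker_pi v b : vsval (coker_pi v b) = b - projv (limg (f v)) b.
Proof.
rewrite comp_lfunE [linfun (vsproj _) _]lfunE /=.
have -> : (\1 - projv (limg (f v)))%VF b = b - projv (limg (f v)) b.
  by rewrite add_lfunE opp_lfunE id_lfunE.
by rewrite vsprojK ?memv_projC.
Qed.

Lemma coker_pi_ker v : lker (coker_pi v) = limg (f v).
Proof.
apply/vspaceP => b; rewrite memv_ker -(inj_eq val_inj).
rewrite [val (coker_pi v b)]val_coker_pi linear0 subr_eq0; apply/eqP/idP => [->|].
  exact: memv_proj.
by move=> /projv_id ->.
Qed.

Lemma coker_pi_val v (c : cob v) : coker_pi v (vsval c) = c.
Proof.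
apply/val_inj; rewrite [LHS]val_coker_pi.
suff -> : projv (limg (f v)) (vsval c) = 0 by rewrite subr0.
by apply/eqP; rewrite -memv_ker lker_proj subvsP.
Qed.

Lemma coker_pi_surj v : limg (coker_pi v) = fullv.
Proof.
apply/vspaceP => c; rewrite memvf; apply/memv_imgP.
by exists (vsval c); rewrite ?memvf ?coker_pi_val.
Qed.

Lemma cmorE v w (h : ple v w) (c : cob v) :
  cmor h c = coker_pi w (mor Y h (vsval c)).
Proof. by rewrite /cmor comp_lfunE [LHS]comp_lfunE [linfun vsval _]lfunE. Qed.

Lemma coker_pi_mor v w (h : ple v w) b :
  coker_pi w (mor Y h b) = cmor h (coker_pi v b).
Proof.
rewrite cmorE val_coker_pi !linearB /= -[LHS]subr0; congr (_ - _).
apply/esym/eqP; rewrite -memv_ker coker_pi_ker.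
have /memv_imgP[a _ ->] := memv_proj (limg (f v)) b.
by rewrite -comp_lfunE -natural comp_lfunE memv_img ?memvf.
Qed.

Fact coker_id v (h : ple v v) : cmor h = \1%VF.
Proof. by apply/lfunP => c; rewrite cmorE mor_id !id_lfunE coker_pi_val. Qed.
Fact coker_comp u v w (huv : ple u v) (hvw : ple v w) (huw : ple u w) :
  cmor huw = (cmor hvw \o cmor huv)%VF.
Proof.
apply/lfunP => c; rewrite [RHS]comp_lfunE cmorE (mor_comp Y huv hvw huw).
rewrite [(_ \o mor Y huv)%VF _]comp_lfunE coker_pi_mor.
by rewrite [cmor huv c]cmorE.
Qed.
Definition coker_functor : pfunctor R l K := PFunctor coker_id coker_comp.

Lemma coker_mor0 : (forall v, limg (f v) = fullv) ->
  forall v w (h : ple v w), mor coker_functor h = 0.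
Proof.
move=> f_surj v w h; apply/lfunP => b; rewrite zero_lfunE.
have /eqP b0 : coker_pi v (vsval b) == 0.
  have sub_img y : y \in limg (f v) by rewrite f_surj memvf.
  by rewrite -memv_ker coker_pi_ker sub_img.
have -> : b = 0 by rewrite -[LHS]coker_pi_val.
exact: linear0.
Qed.
End Cokernel.

End Constructions.

Arguments zero_functor {R l K}.
Arguments nat_id {R l K}.

Definition diagram (R : realType) (l : nat) : Type :=
  {fsfun orthant R l -> nat with 0%N}.

(* \bigoplus_v K(v,-)^(b v)                                                   *)
Definition free_functor (R : realType) (l : nat) (K : fieldType) (b : diagram R l) :
    pfunctor R l K :=
  foldr (@dsum R l K) zero_functor
    (flatten [seq nseq (b v) (representable K v) | v <- finsupp b]).

Definition betti_support (R : realType) (l : nat) (b : diagram R l) :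
  set (orthant R l) := [set v | (0 < b v)%N].

Definition betti_total (R : realType) (l : nat) (b : diagram R l) : nat :=
  \sum_(v <- finsupp b) b v.

(* Exactness of P1 -d-> P0 -e-> X -> 0.                                       *)
Definition right_exact (R : realType) (l : nat) (K : fieldType)
    (P1 P0 X : pfunctor R l K) (d : nattrans P1 P0) (e : nattrans P0 X) : Prop :=
  forall v, limg (d v) = lker (e v) /\ limg (e v) = fullv.

Definition tame (R : realType) (l : nat) (K : fieldType)
    (X : pfunctor R l K) : Prop :=
  exists (b0 b1 : diagram R l)
    (d : nattrans (free_functor K b1) (free_functor K b0))
    (e : nattrans (free_functor K b0) X), right_exact d e.

Definition minimal (R : realType) (l : nat) (K : fieldType)
    (P X : pfunctor R l K) (f : nattrans P X) : Prop :=
  forall g : nattrans P P, (forall v, (f v \o g v)%VF = f v) -> is_iso g.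

(* A presentation is minimal when P0 -> X and P1 -> ker (P0 -> X) are minimal *)
(* covers; as ker (P0 -> X) -> P0 is mono, the latter is minimality of d.     *)
Definition minimal_presentation (R : realType) (l : nat) (K : fieldType)
    (X : pfunctor R l K) (b0 b1 : diagram R l)
    (d : nattrans (free_functor K b1) (free_functor K b0))
    (e : nattrans (free_functor K b0) X) : Prop :=
  [/\ right_exact d e, minimal e & minimal d].

Definition betti (R : realType) (l : nat) (K : fieldType)
    (X : pfunctor R l K) (b0 b1 : diagram R l) : Prop :=
  exists (d : nattrans (free_functor K b1) (free_functor K b0))
    (e : nattrans (free_functor K b0) X),
    minimal_presentation d e.

Definition contour_norm (R : realType) (l : nat) (c : contour R l) (K : fieldType)
    (X : pfunctor R l K) : \bar R :=
  ereal_inf [set (t%:num)%:E | t in [set t : {nonneg R} |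
    forall v w, c (Some v) t = Some w -> forall h : ple v w, mor X h = 0]].

Definition norm_mor (R : realType) (l : nat) (c : contour R l) (K : fieldType)
    (X Y : pfunctor R l K) (f : nattrans X Y) : \bar R :=
  (contour_norm c (ker_functor f) + contour_norm c (coker_functor f))%E.

(* [zigzag c X Y r]: there is a zig-zag of tame functors                      *)
(* X -> W1 <- W2 -> ... <- Y with total cost r.                               *)
Inductive zigzag (R : realType) (l : nat) (c : contour R l) (K : fieldType) :
    pfunctor R l K -> pfunctor R l K -> \bar R -> Prop :=
| zigzag_nil X : zigzag c X X 0%E
| zigzag_cons X W Z Y r (f : nattrans X W) (g : nattrans Z W) :
    tame W -> tame Z -> zigzag c Z Y r ->
    zigzag c X Y (norm_mor c f + norm_mor c g + r)%E.

Definition dN (R : realType) (l : nat) (c : contour R l) (K : fieldType)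
    (X Y : pfunctor R l K) : \bar R :=
  ereal_inf [set r | zigzag c X Y r].

(* Continuity of the identity map from (orthant, dist_oo) to (orthant, dN).   *)
Definition continuous_contour (R : realType) (l : nat) (c : contour R l)
    (K : fieldType) : Prop :=
  forall (v : orthant R l) (e : R), 0 < e ->
    exists2 d : R, 0 < d & forall w, dist_oo v w < d ->
      (dN c (representable K v) (representable K w) < e%:E)%E.

(* For universe reasons the large type [pfunctor] carries no [choiceType]     *)
(* structure.  Isomorphism classes are therefore formed over the small type   *)
(* of functors whose values are the spaces ['rV[K]_d]; by [skeleton_iso]      *)
(* every functor is isomorphic to one of these.                               *)
Record skeletal (R : realType) (l : nat) (K : fieldType) := Skeletal {
  sdim : orthant R l -> nat;
  smor : forall v w, ple v w -> 'Hom('rV[K]_(sdim v), 'rV[K]_(sdim w));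
  smor_id : forall v (h : ple v v), smor h = \1%VF;
  smor_comp : forall u v w (huv : ple u v) (hvw : ple v w) (huw : ple u w),
    smor huw = (smor hvw \o smor huv)%VF
}.

Definition realize (R : realType) (l : nat) (K : fieldType)
    (S : skeletal R l K) : pfunctor R l K :=
  @PFunctor R l K (fun v => 'rV[K]_(sdim S v)) (@smor R l K S) (@smor_id R l K S)
    (@smor_comp R l K S).

Section Skeleton.
Variables (R : realType) (l : nat) (K : fieldType) (X : pfunctor R l K).
Import passmx.
Let sk_dim v : nat := \dim {: X v}.
Let coords v : 'Hom(X v, 'rV[K]_(sk_dim v)) := linfun (rVof (vbasis {: X v})).
Let vect v : 'Hom('rV[K]_(sk_dim v), X v) := linfun (vecof (vbasis {: X v})).
Let sk_mor v w (h : ple v w) := (coords w \o mor X h \o vect v)%VF.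

Fact vectK v : (vect v \o coords v)%VF = \1%VF.
Proof.
apply/lfunP => a; rewrite comp_lfunE id_lfunE /vect /coords !lfunE /=.
by rewrite rVofK ?vbasisP.
Qed.
Fact coordsK v : (coords v \o vect v)%VF = \1%VF.
Proof.
apply/lfunP => a; rewrite comp_lfunE id_lfunE /vect /coords !lfunE /=.
by rewrite vecofK ?vbasisP.
Qed.

Fact sk_id v (h : ple v v) : sk_mor h = \1%VF.
Proof. by rewrite /sk_mor mor_id comp_lfun1r coordsK. Qed.
Fact sk_comp u v w (huv : ple u v) (hvw : ple v w) (huw : ple u w) :
  sk_mor huw = (sk_mor hvw \o sk_mor huv)%VF.
Proof.
rewrite /sk_mor (mor_comp X huv hvw huw) !comp_lfunA; congr (_ \o _ \o _)%VF.
by rewrite -[in RHS]comp_lfunA vectK comp_lfun1r.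
Qed.

Definition skeleton : skeletal R l K := Skeletal sk_id sk_comp.

Fact to_skeleton_natural v w (h : ple v w) :
  (coords w \o mor X h = mor (realize skeleton) h \o coords v)%VF.
Proof. by rewrite /= /sk_mor -!comp_lfunA vectK comp_lfun1r. Qed.
Definition to_skeleton : nattrans X (realize skeleton) :=
  @NatTrans R l K X (realize skeleton) coords to_skeleton_natural.

Fact of_skeleton_natural v w (h : ple v w) :
  (vect w \o mor (realize skeleton) h = mor X h \o vect v)%VF.
Proof. by rewrite /= /sk_mor !comp_lfunA vectK comp_lfun1l. Qed.
Definition of_skeleton : nattrans (realize skeleton) X :=
  @NatTrans R l K (realize skeleton) X vect of_skeleton_natural.

Lemma skeleton_iso : isomorphic X (realize skeleton).
Proof.
by exists to_skeleton, of_skeleton => v; split; [exact: vectK|exact: coordsK].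
Qed.
End Skeleton.

Section Isomorphic.
Variables (R : realType) (l : nat) (K : fieldType).
Implicit Types X Y Z : pfunctor R l K.

Lemma isomorphic_refl X : isomorphic X X.
Proof. by exists (nat_id X), (nat_id X) => v; rewrite comp_lfun1l. Qed.

Lemma isomorphic_sym X Y : isomorphic X Y -> isomorphic Y X.
Proof. by move=> [f [g fg]]; exists g, f => v; have [] := fg v. Qed.

Lemma isomorphic_trans Y X Z :
  isomorphic X Y -> isomorphic Y Z -> isomorphic X Z.
Proof.
move=> [f [f' ff']] [g [g' gg']]; exists (nat_comp g f), (nat_comp f' g') => v /=.
have [f1 f2] := ff' v; have [g1 g2] := gg' v; split.
  by rewrite -comp_lfunA (comp_lfunA (g' v)) g1 comp_lfun1l.
by rewrite -comp_lfunA (comp_lfunA (f v)) f2 comp_lfun1l.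
Qed.

Lemma tame_isomorphic X Y : isomorphic X Y -> tame X -> tame Y.
Proof.
move=> [f [g fg]] [b0 [b1 [d [e de]]]]; exists b0, b1, d, (nat_comp f e) => v.
have [-> eX] := de v; have [gf fgv] := fg v; split.
  apply/vspaceP => a; rewrite !memv_ker comp_lfunE.
  apply/eqP/eqP => [->|fea0]; first by rewrite linear0.
  by rewrite -[e v a]id_lfunE -gf comp_lfunE fea0 linear0.
apply/vspaceP => y; rewrite memvf; apply/memv_imgP.
have : g v y \in limg (e v) by rewrite eX memvf.
move=> /memv_imgP[a _ gy]; exists a; first exact: memvf.
by rewrite comp_lfunE -gy -comp_lfunE fgv id_lfunE.
Qed.
End Isomorphic.

Record tame_skeletal (R : realType) (l : nat) (K : fieldType) := TameSkeletal {
  skeletal_of : skeletal R l K;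
  tame_realize : tame (realize skeletal_of)
}.

HB.instance Definition _ (R : realType) (l : nat) (K : fieldType) :=
  gen_eqMixin (tame_skeletal R l K).
HB.instance Definition _ (R : realType) (l : nat) (K : fieldType) :=
  gen_choiceMixin (tame_skeletal R l K).

Section IsoClasses.
Variables (R : realType) (l : nat) (K : fieldType).
Implicit Types S T : tame_skeletal R l K.

Definition iso_rel S T : bool :=
  `[< isomorphic (realize (skeletal_of S)) (realize (skeletal_of T)) >].

Lemma iso_rel_refl : reflexive iso_rel.
Proof. by move=> S; apply/asboolP; exact: isomorphic_refl. Qed.

Lemma iso_rel_sym : symmetric iso_rel.
Proof. by move=> S T; apply/asboolP/asboolP; exact: isomorphic_sym. Qed.

Lemma iso_rel_trans : transitive iso_rel.
Proof.
move=> T S U /asboolP ST /asboolP TU; apply/asboolP.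
exact: isomorphic_trans ST TU.
Qed.

Canonical iso_equiv := EquivRel iso_rel iso_rel_refl iso_rel_sym iso_rel_trans.

(* The contour is a phantom argument selecting the pseudo-metric below.       *)
Definition iso_class (c : contour R l) : Type := {eq_quot iso_equiv}.

HB.instance Definition _ (c : contour R l) :=
  Choice.copy (iso_class c) {eq_quot iso_equiv}.

Definition tame_skeleton (X : pfunctor R l K) (tX : tame X) :
    tame_skeletal R l K :=
  TameSkeletal (tame_isomorphic (skeleton_iso X) tX).

Definition iso_class_of (c : contour R l) (X : pfunctor R l K) (tX : tame X) :
    iso_class c :=
  \pi_({eq_quot iso_equiv}) (tame_skeleton tX).

Definition representative (c : contour R l) (x : iso_class c) : pfunctor R l K :=
  realize (skeletal_of (repr (x : {eq_quot iso_equiv}))).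

Lemma tame_representative (c : contour R l) (x : iso_class c) :
  tame (representative x).
Proof. exact: tame_realize. Qed.

Lemma class_ofP (c : contour R l) X Y (tX : tame X) (tY : tame Y) :
  iso_class_of c tX = iso_class_of c tY <-> isomorphic X Y.
Proof.
have skX := skeleton_iso X; have skY := skeleton_iso Y.
split=> [/eqmodP/asboolP XY|XY].
  apply: isomorphic_trans skX (isomorphic_trans XY _).
  exact: isomorphic_sym skY.
apply/eqmodP/asboolP.
exact: isomorphic_trans (isomorphic_sym skX) (isomorphic_trans XY skY).
Qed.

Lemma representativeK (c : contour R l) (x : iso_class c) :
  iso_class_of c (tame_representative x) = x.
Proof.
rewrite -[RHS](@reprK _ {eq_quot iso_equiv}); apply/eqmodP/asboolP.
exact: isomorphic_sym (skeleton_iso _).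
Qed.
End IsoClasses.

Section PseudoMetric.
Variables (R : realType) (l : nat) (c : contour R l) (K : fieldType).
Implicit Types X Y Z : pfunctor R l K.
Local Open Scope ereal_scope.

Lemma norm_ge0 X : 0 <= contour_norm c X.
Proof. by apply: le_ereal_inf_tmp => _ [t _ <-]; rewrite lee_fin. Qed.

Lemma norm_mor_ge0 X Y (f : nattrans X Y) : 0 <= norm_mor c f.
Proof. by rewrite adde_ge0 ?norm_ge0. Qed.

Lemma zigzag_ge0 X Y r : zigzag c X Y r -> 0 <= r.
Proof.
elim=> [//|X' W Z Y' s f g _ _ _ s0].
by apply: adde_ge0 s0; apply: adde_ge0; exact: norm_mor_ge0.
Qed.

Lemma zigzag_cat X Y Z r s :
  zigzag c X Y r -> zigzag c Y Z s -> zigzag c X Z (r + s).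
Proof.
elim=> [X'|X' W W' Y' r' f g tW tW' _ IH] YZ; first by rewrite add0e.
by rewrite -addeA; apply: zigzag_cons => //; exact: IH.
Qed.

Lemma zigzag_sym X Y r : tame X -> zigzag c X Y r -> zigzag c Y X r.
Proof.
move=> tX XY; elim: XY tX => [X' _|X' W Z Y' r' f g tW tZ _ IH tX'].
  exact: zigzag_nil.
rewrite addeC (addeC (norm_mor c f)); apply: zigzag_cat (IH tZ) _.
rewrite -[X in zigzag _ _ _ X]adde0.
by apply: zigzag_cons => //; exact: zigzag_nil.
Qed.

Lemma dN_lt X Y (e : \bar R) : dN c X Y < e ->
  exists2 r, zigzag c X Y r & r < e.
Proof. by move=> /ereal_inf_lt[r]; exists r. Qed.

Lemma dN_le X Y r : zigzag c X Y r -> dN c X Y <= r.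
Proof. by move=> ?; exact: ereal_inf_lbound. Qed.

Lemma norm_eq0 X : (forall v w (h : ple v w), mor X h = 0%R) -> contour_norm c X = 0.
Proof.
move=> X0; apply/eqP; rewrite eq_le norm_ge0 andbT.
by apply: ereal_inf_lbound; exists (0%:nng)%R.
Qed.

Lemma norm_mor_iso X Y (f : nattrans X Y) : is_iso f -> norm_mor c f = 0.
Proof.
move=> [g fg]; rewrite /norm_mor !norm_eq0 ?adde0//.
  apply: coker_mor0 => v; apply/vspaceP => b; rewrite memvf; apply/memv_imgP.
  by exists (g v b); rewrite ?memvf// -comp_lfunE (fg v).2 id_lfunE.
apply: ker_mor0 => v; apply/vspaceP => a; rewrite memv_ker memv0.
apply/eqP/eqP => [fa0|->]; last exact: linear0.
by rewrite -[LHS]id_lfunE -(fg v).1 comp_lfunE fa0 linear0.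
Qed.

Lemma dN_sym X Y : tame X -> tame Y -> dN c X Y = dN c Y X.
Proof.
by move=> tX tY; congr ereal_inf; apply/seteqP; split => r; exact: zigzag_sym.
Qed.

Lemma dN_isomorphic X X' Y :
  tame X -> tame X' -> isomorphic X X' -> dN c X Y = dN c X' Y.
Proof.
suff le Z Z' : tame Z' -> isomorphic Z Z' -> dN c Z Y <= dN c Z' Y.
  move=> tX tX' XX'; apply/eqP; rewrite eq_le le// le//.
  exact: isomorphic_sym.
move=> tW [f f_iso]; apply: le_ereal_inf_tmp => r WY.
apply: dN_le; rewrite -[r]add0e; apply: zigzag_cat WY.
have id_iso : is_iso (nat_id Z').
  by exists (nat_id Z') => v; rewrite comp_lfun1l.
have := zigzag_cons f (nat_id Z') tW tW (zigzag_nil c Z').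
by rewrite !norm_mor_iso// !adde0.
Qed.

Lemma dN_representative X Y (tX : tame X) (tY : tame Y) :
  dN c (representative (iso_class_of c tX)) (representative (iso_class_of c tY)) =
  dN c X Y.
Proof.
have rep Z (tZ : tame Z) : isomorphic (representative (iso_class_of c tZ)) Z.
  by apply/(class_ofP c (tame_representative _) tZ); exact: representativeK.
have tx := tame_representative (iso_class_of c tX).
have ty := tame_representative (iso_class_of c tY).
rewrite (dN_isomorphic _ tx tX (rep _ tX)) dN_sym//.
by rewrite (dN_isomorphic _ ty tY (rep _ tY)) dN_sym.
Qed.

Definition class_ball (x : iso_class K c) (e : R) (y : iso_class K c) : Prop :=
  dN c (representative x) (representative y) < e%:E.

Fact class_ball_center x (e : R) : (0 < e)%R -> class_ball x e x.
Proof.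
by move=> e0; apply: le_lt_trans (dN_le (zigzag_nil _ _)) _; rewrite lte_fin.
Qed.

Fact class_ball_sym x y e : class_ball x e y -> class_ball y e x.
Proof.
move=> /dN_lt[r xy re]; apply: le_lt_trans re.
exact/dN_le/(zigzag_sym (tame_representative _)).
Qed.

Fact class_ball_triangle x y z e1 e2 :
  class_ball x e1 y -> class_ball y e2 z -> class_ball x (e1 + e2) z.
Proof.
move=> /dN_lt[r xy re1] /dN_lt[s yz se2].
apply: le_lt_trans (dN_le (zigzag_cat xy yz)) _.
by rewrite EFinD; exact: lteD.
Qed.

HB.instance Definition _ := hasNbhs.Build (iso_class K c)
  (nbhs_ (entourage_ class_ball)).
HB.instance Definition _ := @Nbhs_isPseudoMetric.Build R (iso_class K c)
  (entourage_ class_ball) erefl class_ball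
  class_ball_center class_ball_sym class_ball_triangle erefl.
End PseudoMetric.

Definition complete_set (R : realType) (T : pseudoMetricType R) (A : set T) :
    Prop :=
  forall u : nat -> T, (forall k, A (u k)) -> cauchy (u @ \oo) ->
    exists2 x, A x & u @ \oo --> x.

Definition totally_bounded_set (R : realType) (T : pseudoMetricType R)
    (A : set T) : Prop :=
  forall e : R, 0 < e -> exists F : set T,
    [/\ finite_set F, F `<=` A & A `<=` \bigcup_(x in F) ball x e].

Definition bounded_betti (R : realType) (l : nat) (c : contour R l)
    (K : fieldType) (D : set (orthant R l)) (n m : nat) : set (iso_class K c) :=
  [set x | exists (X : pfunctor R l K) (tX : tame X) (b0 b1 : diagram R l),
    [/\ x = iso_class_of c tX, betti X b0 b1,
        betti_support b0 `<=` D /\ betti_support b1 `<=` D,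
        (betti_total b0 <= n)%N & (betti_total b1 <= m)%N]].
Arguments bounded_betti {R l} c K D n m.

(* Main.v *)
From HB Require Import structures.
Require Import Defs.
From mathcomp Require Import all_boot all_order all_algebra all_fingroup finmap.
From mathcomp Require Import ring lra.
From mathcomp Require Import all_classical all_reals all_analysis.

(* Every functor in T(D,n,m) is the cokernel of a map of free functors given  *)
(* by a matrix M over K together with generator degrees v_i and relation      *)
(* degrees w_j in D such that v_i <= w_j whenever M_ji != 0; conversely, any  *)
(* such presentation shrinks to a minimal one by deleting redundant           *)
(* generators and relations, so T(D,n,m) is exactly the set of these          *)
(* cokernels.  As K is finite there are finitely many matrices, and for a     *)
(* fixed M the admissible degrees form a closed, hence compact, subset of a   *)
(* power of D.  The cokernel depends continuously on the degrees: following   *)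
(* an element along a zig-zag shows that d_N(K(v,-),K(w,-)) < t forces        *)
(* w <= v*t, and if two presentations with the same matrix have degrees       *)
(* within such t-shifts of each other, both receive a map of norm at most 2t  *)
(* from the cokernel on the joined degrees.                                   *)

Set Implicit Arguments.
Unset Strict Implicit.
Unset Printing Implicit Defensive.

Import Order.TTheory GRing.Theory Num.Theory.
Import numFieldNormedType.Exports.

Local Open Scope classical_set_scope.
Local Open Scope ring_scope.

(** Compactness is proved one coefficient matrix at a time. A class lies in T(D,n,m) exactly when it
    has some presentation, minimal or not, with at most n generators and m relations of degrees in D
    ([bounded_bettiP]); minimality has to be dropped because it can be lost in a limit of degrees.
    As K is finite, T(D,n,m) is then a finite union of sets [presented_classes D M].

    For fixed M, take an ultrafilter on such a set. The degrees of chosen presentations converge in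
    the compact set D; the inequalities that make M a morphism of free functors are closed
    conditions, so M on the limit degrees presents a functor ([presented_exists]), whose class is
    the limit ([compact_presented_classes]). The convergence rests on two estimates:
    [dN_representable_shift] turns continuity of the contour into mutual shift inequalities between
    degrees, and [dN_presented_le] turns such inequalities back into the bound 4t on the distance
    between cokernels of the same matrix. Completeness and total boundedness follow from compactness
    in any pseudo-metric space. *)

Section Orthant.
Variables (R : realType) (l : nat).
Implicit Types u v w : orthant R l.

Fact origin_subproof : [set v : 'rV[R]_l | forall i, 0 <= v ord0 i] 0.
Proof. by move=> i; rewrite mxE. Qed.
Definition origin : orthant R l := SigSub (mem_set origin_subproof).

Lemma pcoord_ge0 v i : 0 <= pcoord v i.
Proof. exact: (set_mem (valP v)) i. Qed.

Fact pjoin_subproof v w : [set v : 'rV[R]_l | forall i, 0 <= v ord0 i]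
  (\row_i Num.max (pcoord v i) (pcoord w i)).
Proof. by move=> i; rewrite mxE le_max pcoord_ge0. Qed.
Definition pjoin v w : orthant R l := SigSub (mem_set (pjoin_subproof v w)).

Lemma pcoord_join v w i : pcoord (pjoin v w) i =
  Num.max (pcoord v i) (pcoord w i).
Proof. by rewrite {1}/pcoord mxE. Qed.

Lemma ple_joinl v w : ple v (pjoin v w).
Proof. by apply/forallP => i; rewrite pcoord_join le_max lexx. Qed.

Lemma ple_joinr v w : ple w (pjoin v w).
Proof. by apply/forallP => i; rewrite pcoord_join le_max lexx orbT. Qed.

Lemma pjoin_ple u v w : ple v u -> ple w u -> ple (pjoin v w) u.
Proof.
move=> /forallP vu /forallP wu; apply/forallP => i.
by rewrite pcoord_join ge_max vu wu.
Qed.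
End Orthant.

(** * Functors as subquotients of a constant vector space *)

Section Quotients.
Variables (R : realType) (l : nat) (K : fieldType).
Implicit Types (X Y : pfunctor R l K) (x y : orthant R l).

(* q x identifies X x with the quotient S x / T x; its values off S x are     *)
(* irrelevant.                                                                *)
Definition is_quotient (V : vectType K) (S T : orthant R l -> {vspace V})
    (X : pfunctor R l K) (q : forall x, 'Hom(V, X x)) : Prop :=
  [/\ forall x y, ple x y -> (S x <= S y)%VS,
      forall x (a : X x), exists2 c, c \in S x & q x c = a,
      forall x c, c \in S x -> (q x c == 0) = (c \in T x)
    & forall x y (h : ple x y) c, c \in S x -> mor X h (q x c) = q y c].
Arguments is_quotient [V].

(** Morphisms can thus be given by one linear map of ambient spaces, independent of x; naturality is
    inherited from the compatibility of [q] and [q'] with the structure maps. *)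
Lemma quotient_map (V V' : vectType K) (S T : orthant R l -> {vspace V})
    (S' T' : orthant R l -> {vspace V'}) X Y q q' (L : 'Hom(V, V')) :
  is_quotient S T X q -> is_quotient S' T' Y q' ->
  (forall x c, c \in S x -> L c \in S' x) ->
  (forall x c, c \in S x -> c \in T x -> L c \in T' x) ->
  exists f : nattrans X Y, forall x c, c \in S x -> f x (q x c) = q' x (L c).
Proof.
move=> [Smono q_surj q_ker q_mor] [_ _ q'_ker q'_mor] LS LT.
pose p x : 'Hom(V, X x) := (q x \o projv (S x))%VF.
pose f x : 'Hom(X x, Y x) := (q' x \o L \o projv (S x) \o (p x)^-1)%VF.
have fE x c : c \in S x -> f x (q x c) = q' x (L c).
  move=> cS; rewrite /f !comp_lfunE.
  set c' := projv _ _; have c'S : c' \in S x by rewrite memv_proj.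
  have qc' : q x c' = q x c.
    have : q x c \in limg (p x).
      by apply/memv_imgP; exists c; rewrite ?memvf// comp_lfunE projv_id.
    by move=> /limg_lfunVK; rewrite comp_lfunE.
  have ccS : c' - c \in S x by rewrite rpredB.
  have ccT : c' - c \in T x by rewrite -q_ker// linearB/= qc' subrr.
  apply/eqP; rewrite -subr_eq0 -!linearB/= q'_ker//; last exact: LS.
  exact: LT.
clearbody f.
have f_nat v w (h : ple v w) : (f w \o mor X h = mor Y h \o f v)%VF.
  apply/lfunP => a; have [c cS <-] := q_surj v a.
  have cSw : c \in S w by exact: (subvP (Smono _ _ h)).
  by rewrite !comp_lfunE q_mor// !fE// q'_mor// LS.
by exists (NatTrans f_nat).
Qed.

Lemma bijective_is_iso X Y (f : nattrans X Y) :
  (forall x, lker (f x) = 0%VS) -> (forall x, limg (f x) = fullv) -> is_iso f.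
Proof.
move=> f_inj f_surj.
have fK x : ((f x)^-1 \o f x = \1)%VF by apply: lker0_compVf; rewrite f_inj.
have Kf x : (f x \o (f x)^-1 = \1)%VF.
  by apply/lfunP => a; rewrite comp_lfunE id_lfunE limg_lfunVK// f_surj memvf.
have g_nat v w (h : ple v w) :
    ((f w)^-1 \o mor Y h = mor X h \o (f v)^-1)%VF.
  rewrite -[LHS]comp_lfun1r -(Kf v) comp_lfunA -(comp_lfunA _ (mor Y h)).
  by rewrite -natural (comp_lfunA _ (f w)) fK comp_lfun1l.
by exists (NatTrans g_nat) => x; split; [exact: fK|exact: Kf].
Qed.

Lemma surjective_endo_is_iso X (f : nattrans X X) :
  (forall x, limg (f x) = fullv) -> is_iso f.
Proof.
move=> f_surj; apply: bijective_is_iso => // x; apply/eqP.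
rewrite -dimv_eq0 -(eqn_add2r (\dim (limg (f x)))) add0n.
by rewrite {2}f_surj -(limg_ker_dim (f x) fullv) capfv.
Qed.

Lemma isomorphic_quotient (V : vectType K) (S T : orthant R l -> {vspace V})
    X Y q :
  isomorphic X Y -> is_quotient S T X q ->
  exists q', is_quotient S T Y q'.
Proof.
move=> [f [g fg]] [Smono q_surj q_ker q_mor].
have fK x : cancel (f x) (g x).
  by move=> a; rewrite -comp_lfunE (fg x).1 id_lfunE.
have gK x : cancel (g x) (f x).
  by move=> a; rewrite -comp_lfunE (fg x).2 id_lfunE.
exists (fun x => (f x \o q x)%VF); split => //.
- move=> x b; have [c cS qc] := q_surj x (g x b); exists c => //.
  by rewrite comp_lfunE qc gK.
- move=> x c cS; rewrite comp_lfunE -q_ker//; apply/eqP/eqP => [|->].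
    by move=> /(congr1 (g x)); rewrite fK linear0.
  by rewrite linear0.
- move=> x y h c cS; rewrite !comp_lfunE -(q_mor _ _ h)//.
  by rewrite -comp_lfunE -natural comp_lfunE.
Qed.

Section Free.
Variables (a : nat) (v : 'I_a -> orthant R l).

(* The value at x of the sum of the K(v_i,-), inside the constant space K^a.  *)
Definition freesp x : {vspace 'rV[K]_a} :=
  lker (linfun (mulmxr (diag_mx (\row_i (~~ ple (v i) x)%:R)))).

Lemma freespP x (c : 'rV[K]_a) :
  reflect (forall i, c ord0 i != 0 -> ple (v i) x) (c \in freesp x).
Proof.
rewrite memv_ker lfunE /= mul_mx_diag; apply: (iffP eqP) => [/rowP c0 i|cS].
  move=> ci; apply: contra_neqT ci => vx.
  by have := c0 i; rewrite !mxE vx mulr1.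
apply/rowP => i; rewrite !mxE; case: (boolP (ple _ _)) => /= vx.
  by rewrite mulr0.
by rewrite mulr1; apply: contraNeq vx => /cS.
Qed.

Lemma freesp_mono x y : ple x y -> (freesp x <= freesp y)%VS.
Proof.
move=> xy; apply/subvP => c /freespP cS; apply/freespP => i /cS vx.
exact: ple_trans vx xy.
Qed.

Lemma delta_freesp x i : ple (v i) x -> delta_mx 0 i \in freesp x.
Proof.
move=> vx; apply/freespP => j; rewrite mxE.
by have [->//|_] := eqVneq j i; rewrite andbF eqxx.
Qed.
End Free.

(** The span of those rows of M whose relation is already present at x; the cokernel takes the value
    [freesp v x] modulo this space. *)
Definition relsp a b (w : 'I_b -> orthant R l) (M : 'M[K]_(b, a)) x :
  {vspace 'rV[K]_a} := (linfun (mulmxr M) @: freesp w x)%VS.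

Lemma relspP a b (w : 'I_b -> orthant R l) (M : 'M[K]_(b, a)) x c :
  reflect (exists2 r, r \in freesp w x & c = r *m M) (c \in relsp w M x).
Proof.
by apply: (iffP memv_imgP) => -[r rS ->]; exists r; rewrite // lfunE.
Qed.

(** This makes M a morphism of free functors: a nonzero map from K(w,-) to K(v,-) exists only when v
    is below w. *)
Definition admissible a b (v : 'I_a -> orthant R l) (w : 'I_b -> orthant R l)
  (M : 'M[K]_(b, a)) : Prop := forall j i, M j i != 0 -> ple (v i) (w j).

Lemma admissible_mul a b (v : 'I_a -> orthant R l) w (M : 'M[K]_(b, a)) x r :
  admissible v w M -> r \in freesp w x -> r *m M \in freesp v x.
Proof.
move=> Madm /freespP rS; apply/freespP => i; apply: contra_neqT => vx.
rewrite mxE big1// => j _.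
have [->|Mji] := eqVneq (M j i) 0; first exact: mulr0.
have [->|rj] := eqVneq (r ord0 j) 0; first exact: mul0r.
by case/negP: vx; exact: ple_trans (Madm _ _ Mji) (rS _ rj).
Qed.

Definition presented a b (v : 'I_a -> orthant R l) (w : 'I_b -> orthant R l)
    (M : 'M[K]_(b, a)) (X : pfunctor R l K) : Prop :=
  admissible v w M /\ exists q, is_quotient (freesp v) (relsp w M) X q.

Definition is_free a (v : 'I_a -> orthant R l) X q : Prop :=
  is_quotient (freesp v) (fun=> 0%VS) X q.
Arguments is_free [a].

(** Row j of M is a lift to K^a of the value of [d] on the j-th relation, taken at its degree [w j];
    that the lift lives in [freesp v (w j)] is admissibility. *)
Lemma right_exact_presented a b (v : 'I_a -> orthant R l)
    (w : 'I_b -> orthant R l) P1 P0 X (d : nattrans P1 P0) e q1 q0 :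
  right_exact d e -> is_free v P0 q0 -> is_free w P1 q1 ->
  exists2 M, admissible v w M &
   is_quotient (freesp v) (relsp w M) X (fun x => (e x \o q0 x)%VF).
Proof.
move=> de [_ q0_surj q0_ker q0_mor] [_ q1_surj q1_ker q1_mor].
pose gen j : 'rV[K]_b := delta_mx 0 j.
have /choice[m mP] (j : 'I_b) : exists c : 'rV[K]_a, c \in freesp v (w j) /\
    q0 (w j) c = d (w j) (q1 (w j) (gen j)).
  by have [c cS cE] := q0_surj (w j) (d (w j) (q1 (w j) (gen j))); exists c.
pose M := \matrix_j m j.
have M_adm : admissible v w M.
  by move=> j i; rewrite mxE; have [/freespP mS _] := mP j; exact: mS.
have q0M x r : r \in freesp w x -> q0 x (r *m M) = d x (q1 x r).
  move=> /freespP rS; rewrite {2}(row_sum_delta r) mulmx_sum_row !linear_sum /=.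
  apply: eq_bigr => j _; rewrite !linearZ/=.
  have [->|rj] := eqVneq (r ord0 j) 0; first by rewrite !scale0r.
  have wx := rS _ rj; have [mS mE] := mP j.
  rewrite rowK -(q0_mor _ _ wx)// mE -(q1_mor _ _ wx) ?delta_freesp ?ple_refl//.
  by congr (_ *: _); rewrite -!comp_lfunE natural.
exists M => //; split.
- exact: freesp_mono.
- move=> x b'; have : b' \in limg (e x) by rewrite (de x).2 memvf.
  move=> /memv_imgP[p _ ->]; have [c cS <-] := q0_surj x p.
  by exists c => //; rewrite comp_lfunE.
- move=> x c cS; rewrite comp_lfunE -memv_ker -(de x).1.
  apply/memv_imgP/relspP => [[p _]|[r rS ->]].
    have [r rS <-] := q1_surj x p; rewrite -q0M// => /eqP.
    rewrite -subr_eq0 -linearB/= q0_ker ?memv0 ?subr_eq0 => [/eqP->|].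
      by exists r.
    by rewrite rpredB// (admissible_mul M_adm).
  by exists (q1 x r); rewrite ?memvf// q0M.
- move=> x y h c cS.
  by rewrite !comp_lfunE -comp_lfunE -natural comp_lfunE q0_mor.
Qed.

End Quotients.
Arguments is_quotient {R l K V} S T X q.
Arguments is_free {R l K a} v X q.
Arguments freesp {R l K a} v x.
Arguments presented {R l K a b} v w M X.

(** * Coordinates on free functors and their Betti diagrams *)

Section FreeFunctors.
Variables (R : realType) (l : nat) (K : fieldType).
Implicit Types (X Y : pfunctor R l K) (x y : orthant R l).

Section Cons.
Variables (a : nat) (v : 'I_a -> orthant R l) (u : orthant R l).
Variables (X : pfunctor R l K) (q : forall x, 'Hom('rV[K]_a, X x)).

(** The constant row has length 1 or 0 according to whether u is below x, so coordinate 0 disappears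
    where K(u,-) is zero. *)
Let qcons_fun x (c : 'rV[K]_a.+1) : dsum (representable K u) X x :=
  (const_mx (c ord0 ord0), q x (col' ord0 c)).

Fact qcons_linear x : linear (qcons_fun x).
Proof.
move=> k c1 c2; rewrite /qcons_fun; congr pair => /=.
  by apply/matrixP => i j; rewrite !mxE.
by rewrite !linearP.
Qed.
HB.instance Definition _ x :=
  GRing.isLinear.Build K _ _ _ (qcons_fun x) (qcons_linear x).

Definition qcons x : 'Hom('rV[K]_a.+1, dsum (representable K u) X x) :=
  linfun (qcons_fun x).

Lemma qconsE x c : qcons x c = (const_mx (c ord0 ord0), q x (col' ord0 c)).
Proof. by rewrite lfunE. Qed.

Lemma is_free_cons (v' : 'I_a.+1 -> orthant R l) :
  v' ord0 = u -> (forall i, v' (lift ord0 i) = v i) ->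
  is_free v X q -> is_free v' (dsum (representable K u) X) qcons.
Proof.
move=> v'0 v'S [_ q_surj q_ker q_mor].
have tail_freesp x (c : 'rV_a.+1) :
    c \in freesp v' x -> col' ord0 c \in freesp v x.
  by move=> /freespP cS; apply/freespP => i; rewrite mxE -v'S; exact: cS.
split.
- exact: freesp_mono.
- move=> x [/= p y]; have [c /freespP cS <-] := q_surj x y.
  exists (\row_i oapp (c ord0) (\sum_j p ord0 j) (unlift ord0 i)).
    apply/freespP => i; rewrite mxE; case: unliftP => [j|] -> /=.
      by rewrite v'S; exact: cS.
    rewrite v'0; apply: contra_neqT => ux; rewrite big1// => j _.
    by have := ltn_ord j; rewrite [X in (_ < nat_of_bool X)%N](negbTE ux).
  rewrite qconsE; congr pair.
    apply/rowP => i; rewrite !mxE unlift_none /= (bigD1 i)//= big1 ?addr0//.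
    by move=> j /negP[]; apply/eqP; exact: ord_bool_inj.
  by congr (q x _); apply/rowP => i; rewrite !mxE liftK.
- move=> x c cS; rewrite qconsE memv0; apply/eqP/eqP => [[c0 qc]|->].
    have /eqP c'0 : col' ord0 c == 0.
      by rewrite -memv0 -(q_ker x) ?tail_freesp// qc.
    apply/rowP => i; rewrite mxE; case: (unliftP ord0 i) => [j|] ->.
      by move/rowP: c'0 => /(_ j); rewrite !mxE.
    apply: contra_eq c0 => ci; have ux : ple u x.
      by rewrite -v'0; move/freespP: cS; apply.
    apply/eqP => /rowP; rewrite /= ux => /(_ ord0).
    by rewrite !mxE => /eqP; rewrite (negbTE ci).
  congr pair; last by rewrite linear0 linear0.
  by apply/rowP => i; rewrite !mxE.
- move=> x y h c cS; rewrite !qconsE lfunE /=; congr pair.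
    rewrite lfunE; apply/rowP => i; rewrite !mxE (eq_bigr (fun=> c ord0 ord0)).
      rewrite sumr_const card_ord.
      have [->|ci] := eqVneq (c ord0 ord0) 0; first by rewrite mul0rn.
      by move/freespP: cS => /(_ _ ci); rewrite v'0 => ->.
    by move=> j _; rewrite !mxE mulr1.
  exact/q_mor/tail_freesp.
Qed.
End Cons.

Definition free_seq (s : seq (orthant R l)) : pfunctor R l K :=
  foldr (@dsum R l K) zero_functor (map (representable K) s).

Lemma free_seqP (u : orthant R l) s :
  exists q, is_free (fun i : 'I_(size s) => nth u s i) (free_seq s) q.
Proof.
elim: s => [|v s [q q_free]].
  exists (fun=> 0); split => [|x a|x c cS|x y h c cS] /=.
  - exact: freesp_mono.
  - by exists 0; rewrite ?mem0v// lfunE/= (thinmx0 a).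
  - by rewrite zero_lfunE eqxx memv0; apply/esym/eqP/rowP => -[].
  - by rewrite !zero_lfunE linear0.
exists (qcons v q).
by apply: (@is_free_cons _ (fun i : 'I_(size s) => nth u s i)).
Qed.

Lemma is_free_perm a a' (v : 'I_a -> orthant R l) (v' : 'I_a' -> orthant R l)
    (g : 'I_a' -> 'I_a) X q :
  bijective g -> (forall i, v' i = v (g i)) -> is_free v X q ->
  exists q', is_free v' X q'.
Proof.
move=> [h gK hK] v'E [_ q_surj q_ker q_mor].
pose G : 'M[K]_(a', a) := \matrix_(i, j) (g i == j)%:R.
pose L : 'Hom('rV[K]_a', 'rV[K]_a) := linfun (mulmxr G).
have LE c j : L c ord0 j = c ord0 (h j).
  rewrite lfunE /= mxE (bigD1 (h j))//= mxE hK eqxx mulr1 big1 ?addr0// => i ij.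
  rewrite mxE; case: eqP => [gij|_]; last by rewrite mulr0.
  by case/eqP: ij; rewrite -gij gK.
have LS x c : c \in freesp v' x -> L c \in freesp v x.
  by move=> /freespP cS; apply/freespP => j; rewrite LE => /cS; rewrite v'E hK.
exists (fun x => (q x \o L)%VF); split.
- exact: freesp_mono.
- move=> x p; have [c /freespP cS <-] := q_surj x p.
  exists (\row_i c ord0 (g i)).
    by apply/freespP => i; rewrite mxE v'E; exact: cS.
  by rewrite comp_lfunE; congr (q x _); apply/rowP => j; rewrite LE mxE hK.
- move=> x c cS; rewrite comp_lfunE q_ker ?LS// !memv0.
  apply/eqP/eqP => [/rowP Lc|->]; last exact: linear0.
  by apply/rowP => i; rewrite -[i]gK -LE Lc !mxE.
- by move=> x y xy c cS; rewrite !comp_lfunE q_mor// LS.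
Qed.

Definition diagram_seq (b : diagram R l) : seq (orthant R l) :=
  flatten [seq nseq (b v) v | v <- finsupp b].

Lemma free_functorE b : free_functor K b = free_seq (diagram_seq b).
Proof.
rewrite /free_functor /free_seq /diagram_seq map_flatten -map_comp.
by under [in RHS]eq_map do rewrite /= map_nseq.
Qed.

Lemma size_diagram_seq b : size (diagram_seq b) = betti_total b.
Proof.
rewrite /diagram_seq /betti_total size_flatten /shape -map_comp sumnE big_map.
by under eq_bigr do rewrite /= size_nseq.
Qed.

Lemma mem_diagram_seq b v : v \in diagram_seq b -> (0 < b v)%N.
Proof.
by move=> /flatten_mapP[u _]; rewrite mem_nseq => /andP[bu /eqP ->].
Qed.

Lemma free_functorP (b : diagram R l) :
  exists (v : 'I_(betti_total b) -> orthant R l) q,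
  is_free v (free_functor K b) q /\ forall i, betti_support b (v i).
Proof.
rewrite free_functorE -size_diagram_seq.
case E: (diagram_seq b) => [|u s].
  have [q q_free] := free_seqP (origin R l) [::]; eexists _, q.
  by split; [exact: q_free|case].
rewrite -E; have [q q_free] := free_seqP u (diagram_seq b); eexists _, q.
by split; [exact: q_free|move=> i; apply: mem_diagram_seq; rewrite mem_nth].
Qed.

End FreeFunctors.

Section FreeDiagram.
Variables (R : realType) (l : nat) (K : fieldType).

Lemma count_flatten_nseq (T : choiceType) (b : {fsfun T -> nat with 0%N}) u :
  count_mem u (flatten [seq nseq (b v) v | v <- finsupp b]) = b u.
Proof.
rewrite count_flatten -map_comp sumnE big_map.
under eq_bigr do rewrite /= count_nseq.
have [ub|ub] := boolP (u \in finsupp b).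
  rewrite (bigD1_seq u)//= eqxx mul1n big1 ?addn0// => v /negbTE.
  by move=> ->; rewrite mul0n.
rewrite fsfun_dflt// big_seq big1// => v vb /=.
by case: eqP => [vu|_]; [case/negP: ub; rewrite -vu|rewrite mul0n].
Qed.

Lemma count_fsfun (T : choiceType) (s : seq T) :
  exists b : {fsfun T -> nat with 0%N}, forall u, b u = count_mem u s.
Proof.
exists [fsfun u in [fset u in s]%fset => count_mem u s | 0%N] => u.
rewrite fsfunE inE; case: ifPn => // us.
by apply/esym/eqP; rewrite -leqn0 leqNgt -has_count has_pred1.
Qed.

(** The diagram counts multiplicities. It lists the degrees in another order than [v], whence the
    permutation. *)
Lemma diagram_of a (v : 'I_a -> orthant R l) : exists b : diagram R l,
  [/\ betti_total b = a, forall u, betti_support b u -> exists i, u = v i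
    & exists q, is_free v (free_functor K b) q].
Proof.
pose t := [tuple v i | i < a].
have [b bE] : exists b : diagram R l, forall u, b u = count_mem u t.
  exact: count_fsfun.
have b_perm : perm_eq t (diagram_seq b).
  by apply/allP => u _; apply/eqP; rewrite [RHS]count_flatten_nseq bE.
have b_size : size (diagram_seq b) = a.
  by rewrite -(perm_size b_perm) size_tuple.
exists b; split.
- by rewrite -size_diagram_seq.
- move=> u; rewrite /betti_support /= bE -has_count has_pred1.
  by move=> /mapP[i _ ->]; exists i.
- pose s : a.-tuple (orthant R l) := Tuple (introT eqP b_size).
  have /tuple_permP[p tp] : perm_eq t s by [].
  have [q q_free] := free_seqP K (origin R l) (diagram_seq b).
  rewrite free_functorE.
  apply: (is_free_perm (g := fun i => cast_ord (esym b_size) (p i))) q_free.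
    exists (fun j => (p^-1)%g (cast_ord b_size j)) => j.
      by rewrite cast_ord_comp cast_ord_id permK.
    by rewrite permKV cast_ord_comp cast_ord_id.
  move=> i; have := congr1 (fun r => nth (origin R l) r i) tp.
  rewrite -!tnth_nth !tnth_mktuple => ->.
  by rewrite (tnth_nth (origin R l)).
Qed.
End FreeDiagram.

(** * A criterion for minimality of a map out of a free functor *)

Section Presented.
Variables (R : realType) (l : nat) (K : fieldType).
Implicit Types (X Y : pfunctor R l K).

Section Minimal.
Variables (a b : nat) (v : 'I_a -> orthant R l) (w : 'I_b -> orthant R l).

(* If f g = f then q e_j - g (q e_j) lies in the kernel of f, so it only      *)
(* involves generators of degree strictly below v_j; by induction on v_j the  *)
(* image of g contains every generator.                                       *)
Lemma free_minimal (P X : pfunctor R l K) q (f : nattrans P X) :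
  is_free v P q ->
  (forall j c, c \in freesp v (v j) -> f (v j) (q (v j) c) = 0 ->
     c ord0 j = 0) ->
  minimal f.
Proof.
move=> [_ q_surj q_ker q_mor] irr g fg; apply: surjective_endo_is_iso.
have gen j x : ple (v j) x -> q x (delta_mx 0 j) \in limg (g x).
  (* The order on degrees is not well-founded, so the induction counts the generators of degree at
     most [v j]. *)
  have [k] := ubnP #|[pred i | ple (v i) (v j)]|.
  elim: k j x => // k IH j x jk vx.
  pose e : 'rV[K]_a := delta_mx 0 j.
  have eS : e \in freesp v (v j) by rewrite delta_freesp ?ple_refl.
  have [c cS cE] := q_surj (v j) (q (v j) e - g (v j) (q (v j) e)).
  have fc0 : f (v j) (q (v j) c) = 0.
    by rewrite cE linearB/= -(comp_lfunE (f _) (g _)) fg subrr.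
  (* [c] remains in the kernel when pushed to [v i], where [irr] applies to the generator i; what
     survives in [c] lies strictly below [v j]. *)
  have c0 i : ple (v j) (v i) -> c ord0 i = 0.
    move=> ji; apply: irr; first exact: (subvP (freesp_mono _ _ ji)).
    by rewrite -(q_mor _ _ ji)// -comp_lfunE natural comp_lfunE fc0 linear0.
  have -> : q x e = q x c + g x (q x e).
    rewrite -!(q_mor _ _ vx)// cE linearB/= -(comp_lfunE (g x)) natural.
    by rewrite comp_lfunE subrK.
  rewrite rpredD ?memv_img ?memvf// (row_sum_delta c) linear_sum.
  apply: rpred_sum => i _; rewrite linearZ/=.
  have [->|ci] := eqVneq (c ord0 i) 0; first by rewrite scale0r mem0v.
  have ij : ple (v i) (v j) by move/freespP: cS; apply.
  rewrite rpredZ// IH ?(ple_trans ij vx)//.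
  rewrite -ltnS (leq_trans _ jk)// ltnS proper_card//.
  apply/fintype.properP; split.
    by apply/fintype.subsetP => i'; rewrite !inE => /ple_trans; apply.
  exists j; rewrite !inE ?ple_refl//.
  by apply: contraNN ci => /c0 ->.
move=> x; apply/vspaceP => p; rewrite memvf.
have [c /freespP cS <-] := q_surj x p.
rewrite (row_sum_delta c) linear_sum rpred_sum// => i _; rewrite linearZ/=.
have [->|ci] := eqVneq (c ord0 i) 0; first by rewrite scale0r mem0v.
by rewrite rpredZ// gen// cS.
Qed.
End Minimal.
End Presented.

(** * Shrinking presentations to minimal ones, and T(D,n,m) via presentations *)

Section Reduction.
Variables (R : realType) (l : nat) (K : fieldType).
Implicit Types (X Y : pfunctor R l K).

Section Insert.
Variables (a : nat) (j : 'I_a.+1).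

(** Right multiplication by this matrix inserts a zero at position j. *)
Definition insmx : 'M[K]_(a, a.+1) := row' j 1%:M.

Lemma insmxE (c : 'rV[K]_a) i :
  (c *m insmx) ord0 i = oapp (c ord0) 0 (unlift j i).
Proof.
rewrite mxE; case: unliftP => [k|] -> /=.
  rewrite (bigD1 k)//= !mxE eqxx mulr1 big1 ?addr0// => k' kk'.
  by rewrite !mxE (inj_eq lift_inj) (negbTE kk') mulr0.
by rewrite big1// => k _; rewrite !mxE eq_sym (negbTE (neq_lift _ _)) mulr0.
Qed.

Lemma ins_freesp (v : 'I_a.+1 -> orthant R l) x (c : 'rV[K]_a) :
  c \in freesp (v \o lift j) x -> c *m insmx \in freesp v x.
Proof.
move=> /freespP cS; apply/freespP => i; rewrite insmxE.
by case: unliftP => [k ->|_] /=; [exact: cS|rewrite eqxx].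
Qed.

Lemma del_freesp (v : 'I_a.+1 -> orthant R l) x (c : 'rV[K]_a.+1) :
  c \in freesp v x -> col' j c \in freesp (v \o lift j) x.
Proof. by move=> /freespP cS; apply/freespP => i; rewrite mxE; exact: cS. Qed.

Lemma ins_del (c : 'rV[K]_a.+1) : c ord0 j = 0 -> col' j c *m insmx = c.
Proof.
move=> cj; apply/rowP => i; rewrite insmxE.
by case: unliftP => [k|] -> /=; rewrite ?mxE.
Qed.
End Insert.

(** The syzygy r writes row k as a combination of rows present no later than [w k], so deleting row
    k leaves every [relsp] unchanged. *)
Lemma drop_relation a b (v : 'I_a -> orthant R l) (w : 'I_b.+1 -> orthant R l)
    M X k (r : 'rV[K]_b.+1) :
  presented v w M X -> r \in freesp w (w k) -> r ord0 k != 0 -> r *m M = 0 ->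
  presented v (w \o lift k) (insmx k *m M) X.
Proof.
move=> [Madm [q q_pres]] rS rk rM; split.
  by move=> j i; rewrite /insmx row'Esub mul_rowsub_mx mul1mx !mxE; exact: Madm.
exists q; suff -> : relsp (w \o lift k) (insmx k *m M) = relsp w M by [].
apply/funext => x; apply/vspaceP => c.
apply/relspP/relspP => -[s sS ->].
  by exists (s *m insmx k); rewrite ?mulmxA// ins_freesp.
pose t := s - (s ord0 k / r ord0 k) *: r.
have tk : t ord0 k = 0 by rewrite !mxE divfK ?subrr.
have tS : t \in freesp w x.
  rewrite rpredB//; have [->|sk] := eqVneq (s ord0 k) 0.
    by rewrite mul0r scale0r mem0v.
  have wx : ple (w k) x by move/freespP: sS; exact.
  by rewrite rpredZ// (subvP (freesp_mono _ _ wx)).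
exists (col' k t); first exact: del_freesp.
by rewrite mulmxA ins_del// mulmxBl -scalemxAl rM scaler0 subr0.
Qed.

(** The relation c, already valid at [v j], expresses the j-th generator through others of degree at
    most [v j], so it can be eliminated at every x where it exists. *)
Lemma drop_generator a b (v : 'I_a.+1 -> orthant R l) (w : 'I_b -> orthant R l)
    M X j (c : 'rV[K]_a.+1) :
  presented v w M X -> c \in freesp v (v j) -> c \in relsp w M (v j) ->
  c ord0 j != 0 ->
  exists M', presented (v \o lift j) w M' X.
Proof.
move=> [Madm [q [_ q_surj q_ker q_mor]]] cS cT cj.
(* Substituting for the j-th generator according to the relation c.           *)
pose A : 'M[K]_(a.+1, a) :=
  col' j (1%:M - (c ord0 j)^-1 *: (delta_mx j 0 *m c)).
have AE s : s *m A = col' j (s - (s ord0 j / c ord0 j) *: c).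
  rewrite /A !col'Esub mulmx_colsub mulmxBr mulmx1 -scalemxAr mulmxA -colE.
  by rewrite mulrC -scalerA [col j s]mx11_scalar mxE mul_scalar_mx.
have coefS x (s : 'rV[K]_a.+1) :
    s \in freesp v x -> (s ord0 j / c ord0 j) *: c \in freesp v x.
  move=> /freespP sS; have [->|sj] := eqVneq (s ord0 j) 0.
    by rewrite mul0r scale0r mem0v.
  by rewrite rpredZ// (subvP (freesp_mono _ _ (sS _ sj))).
have AS x s : s \in freesp v x -> s *m A \in freesp (v \o lift j) x.
  by move=> sS; rewrite AE del_freesp// rpredB// coefS.
have qA x s : s \in freesp v x -> q x (s *m A *m insmx j) = q x s.
  move=> sS; rewrite AE ins_del; last by rewrite !mxE divfK ?subrr.
  rewrite linearB/= linearZ/=.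
  have [->|sj] := eqVneq (s ord0 j) 0; first by rewrite mul0r scale0r subr0.
  have vx : ple (v j) x by move/freespP: sS; exact.
  have /eqP qc : q (v j) c == 0 by rewrite q_ker.
  by rewrite -(q_mor _ _ vx c)// qc linear0 scaler0 subr0.
exists (M *m A); split.
  move=> k i Mki; have rS : row k M \in freesp v (w k).
    by apply/freespP => i'; rewrite mxE; exact: Madm.
  by move/freespP: (AS _ _ rS) => /(_ i); rewrite -row_mul mxE; exact.
exists (fun x => (q x \o linfun (mulmxr (insmx j)))%VF); split.
- exact: freesp_mono.
- move=> x p; have [s sS <-] := q_surj x p.
  by exists (s *m A); rewrite ?AS// comp_lfunE lfunE /= qA.
- move=> x s sS; rewrite comp_lfunE lfunE /= q_ker ?ins_freesp//.
  apply/relspP/relspP => -[r rS].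
    move=> sE; exists r; rewrite // mulmxA -sE AE.
    have s0 : (s *m insmx j) ord0 j = 0 by rewrite insmxE unlift_none.
    rewrite s0 mul0r scale0r subr0; apply/rowP => i.
    by rewrite mxE insmxE liftK.
  move=> sE; have rMS := admissible_mul Madm rS.
  have : q x (s *m insmx j) == 0.
    by rewrite sE mulmxA qA// q_ker//; apply/relspP; exists r.
  by rewrite q_ker ?ins_freesp// => /relspP.
- by move=> x y xy s sS; rewrite !comp_lfunE !lfunE /= q_mor// ins_freesp.
Qed.

(** The two clauses are the hypotheses of [free_minimal] for P0 -> X and for P1 -> P0, read in
    coordinates. *)
Definition irredundant a b (v : 'I_a -> orthant R l) (w : 'I_b -> orthant R l)
    (M : 'M[K]_(b, a)) : Prop :=
  (forall j c, c \in freesp v (v j) -> c \in relsp w M (v j) -> c ord0 j = 0) /\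
  (forall k r, r \in freesp w (w k) -> r *m M = 0 -> r ord0 k = 0).

(** Each deletion lowers a + b and introduces no new degrees, so the process stops inside D. *)
Lemma irredundant_presentation (D : set (orthant R l)) a b v w
    (M : 'M[K]_(b, a)) X :
  (forall i, D (v i)) -> (forall j, D (w j)) -> presented v w M X ->
  exists a' b' v' w' (M' : 'M[K]_(b', a')),
    [/\ (a' <= a)%N && (b' <= b)%N, forall i, D (v' i), forall j, D (w' j),
        presented v' w' M' X & irredundant v' w' M'].
Proof.
have [k] := ubnP (a + b)%N; elim: k a b v w M => // k IH a b v w M abk vD wD MX.
have [[j [c [cS cT cj]]]|no_gen] := pselect (exists j c,
    [/\ c \in freesp v (v j), c \in relsp w M (v j) & c ord0 j != 0]).
  destruct a as [|a]; first by have := ltn_ord j.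
  have [M' M'X] := drop_generator MX cS cT cj.
  have [a' [b' [v' [w' [M'' [/andP[a'a b'b] vD' wD' M''X irr]]]]]] :=
    IH _ _ _ _ _ abk (fun i => vD (lift j i)) wD M'X.
  by exists a', b', v', w', M''; split => //; rewrite b'b ltnW.
have [[j [r [rS rM rj]]]|no_rel] := pselect (exists j r,
    [/\ r \in freesp w (w j), r *m M = 0 & r ord0 j != 0]).
  destruct b as [|b]; first by have := ltn_ord j.
  have M'X := drop_relation MX rS rj rM.
  rewrite addnS in abk.
  have [a' [b' [v' [w' [M'' [/andP[a'a b'b] vD' wD' M''X irr]]]]]] :=
    IH _ _ _ _ _ abk vD (fun i => wD (lift j i)) M'X.
  by exists a', b', v', w', M''; split => //; rewrite a'a ltnW.
exists a, b, v, w, M; split => //; first by rewrite !leqnn.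
split=> [j c cS cT|j r rS rM]; apply/eqP.
  by apply: contra_notT no_gen => cj; exists j, c.
by apply: contra_notT no_rel => rj; exists j, r.
Qed.

Lemma presented_right_exact a b (v : 'I_a -> orthant R l)
    (w : 'I_b -> orthant R l) M X P0 P1 q q0 q1 :
  admissible v w M -> is_quotient (freesp v) (relsp w M) X q ->
  is_free v P0 q0 -> is_free w P1 q1 ->
  exists (d : nattrans P1 P0) (e : nattrans P0 X),
    [/\ right_exact d e,
        forall x c, c \in freesp v x -> e x (q0 x c) = q x c &
        forall x r, r \in freesp w x -> d x (q1 x r) = q0 x (r *m M)].
Proof.
move=> Madm q_pres free0 free1.
have [e eE] := quotient_map (L := \1%VF) free0 q_pres
  (fun x c => ltac:(by rewrite id_lfunE))
  (fun x c _ => ltac:(by rewrite memv0 id_lfunE => /eqP ->; exact: mem0v)).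
have [d dE] := quotient_map (L := linfun (mulmxr M)) free1 free0
  (fun x c => ltac:(by rewrite lfunE; exact: admissible_mul))
  (fun x c _ => ltac:(by rewrite !memv0 => /eqP ->; rewrite linear0)).
have {}eE x c : c \in freesp v x -> e x (q0 x c) = q x c.
  by move=> cS; rewrite eE// id_lfunE.
have {}dE x r : r \in freesp w x -> d x (q1 x r) = q0 x (r *m M).
  by move=> rS; rewrite dE// lfunE.
exists d, e; split=> // x.
have [_ q_surj q_ker _] := q_pres; have [_ q0_surj q0_ker _] := free0.
have [_ q1_surj _ _] := free1; split.
  apply/vspaceP => p; have [c cS <-] := q0_surj x p.
  rewrite memv_ker eE// q_ker//; apply/memv_imgP/relspP => [[y _]|[r rS ->]].
    have [r rS <-] := q1_surj x y; rewrite dE// => /eqP.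
    rewrite -subr_eq0 -linearB /= q0_ker.
      by rewrite memv0 subr_eq0 => /eqP ->; exists r.
    by rewrite rpredB// (admissible_mul Madm).
  by exists (q1 x r); rewrite ?memvf ?dE.
apply/vspaceP => p; rewrite memvf; apply/memv_imgP.
have [c cS <-] := q_surj x p.
by exists (q0 x c); rewrite ?memvf ?eE.
Qed.

Lemma presented_betti (D : set (orthant R l)) a b v w (M : 'M[K]_(b, a)) X :
  (forall i, D (v i)) -> (forall j, D (w j)) -> presented v w M X ->
  exists b0 b1 : diagram R l,
    [/\ betti X b0 b1, betti_support b0 `<=` D, betti_support b1 `<=` D,
        (betti_total b0 <= a)%N & (betti_total b1 <= b)%N].
Proof.
move=> vD wD MX.
have [a' [b' [v' [w' [M' [ab v'D w'D M'X [irr0 irr1]]]]]]] :=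
  irredundant_presentation vD wD MX.
have [/andP[a'a b'b] [Madm [q qX]]] := (ab, M'X).
have [b0 [b0a b0v [q0 free0]]] := diagram_of K v'.
have [b1 [b1b b1w [q1 free1]]] := diagram_of K w'.
exists b0, b1; rewrite b0a b1b; split=> //; last 2 first.
- by move=> _ /b0v[i ->].
- by move=> _ /b1w[i ->].
have [d [e [de eE dE]]] := presented_right_exact Madm qX free0 free1.
have [_ _ q_ker _] := qX; have [_ _ q0_ker _] := free0.
exists d, e; split => //.
  apply: (free_minimal free0) => j c cS /eqP.
  by rewrite eE// q_ker//; exact: irr0.
apply: (free_minimal free1) => j r rS /eqP.
rewrite dE// q0_ker ?(admissible_mul Madm)//.
by rewrite memv0 => /eqP; exact: irr1.
Qed.

Lemma presented_tame a b v w (M : 'M[K]_(b, a)) X : presented v w M X -> tame X.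
Proof.
move=> [Madm [q qX]].
have [b0 [_ _ [q0 free0]]] := diagram_of K v.
have [b1 [_ _ [q1 free1]]] := diagram_of K w.
have [d [e [de _ _]]] := presented_right_exact Madm qX free0 free1.
by exists b0, b1, d, e.
Qed.

Lemma presented_exists a b v w (M : 'M[K]_(b, a)) :
  admissible v w M -> exists X : pfunctor R l K, presented v w M X.
Proof.
move=> Madm.
have [b0 [_ _ [q0 free0]]] := diagram_of K v.
have [b1 [_ _ [q1 free1]]] := diagram_of K w.
have [d dE] := quotient_map (L := linfun (mulmxr M)) free1 free0
  (fun x c => ltac:(by rewrite lfunE; exact: admissible_mul))
  (fun x c _ => ltac:(by rewrite !memv0 => /eqP ->; rewrite linear0)).
exists (coker_functor d); split=> //.
pose q x := (coker_pi d x \o q0 x)%VF.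
have qE x c : q x c = coker_pi d x (q0 x c) by rewrite /q [LHS]comp_lfunE.
clearbody q; exists q.
have [_ q0_surj q0_ker q0_mor] := free0; have [_ q1_surj _ _] := free1.
split.
- exact: freesp_mono.
- move=> x p; have : p \in limg (coker_pi d x) by rewrite coker_pi_surj memvf.
  move=> /memv_imgP[y _ ->]; have [c cS <-] := q0_surj x y.
  by exists c; rewrite // qE.
- move=> x c cS; rewrite qE -memv_ker coker_pi_ker.
  apply/memv_imgP/relspP => [[y _]|[r rS ->]].
    have [r rS <-] := q1_surj x y; rewrite dE// lfunE /= => /eqP.
    rewrite -subr_eq0 -linearB /= q0_ker.
      by rewrite memv0 subr_eq0 => /eqP ->; exists r.
    by rewrite rpredB// (admissible_mul Madm).
  by exists (q1 x r); rewrite ?memvf ?dE// lfunE.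
- by move=> x y h c cS; rewrite !qE -coker_pi_mor q0_mor.
Qed.

Lemma betti_presented X b0 b1 : betti X b0 b1 ->
  exists v w (M : 'M[K]_(betti_total b1, betti_total b0)),
    [/\ presented v w M X, forall i, betti_support b0 (v i)
      & forall j, betti_support b1 (w j)].
Proof.
move=> [d [e [de _ _]]].
have [v [q0 [free0 vb]]] := free_functorP K b0.
have [w [q1 [free1 wb]]] := free_functorP K b1.
have [M Madm qX] := right_exact_presented de free0 free1.
by exists v, w, M; split=> //; split=> //; eexists; exact: qX.
Qed.

Lemma isomorphic_presented a b v w (M : 'M[K]_(b, a)) X Y :
  isomorphic X Y -> presented v w M X -> presented v w M Y.
Proof.
by move=> XY [Madm [q qX]]; split=> //; exact: isomorphic_quotient XY qX.
Qed.

(** Trades minimal presentations for arbitrary ones, a condition that survives passage to limits of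
    degrees. *)
Lemma bounded_bettiP (c : contour R l) (D : set (orthant R l)) n m x :
  bounded_betti c K D n m x <->
  exists a b v w (M : 'M[K]_(b, a)),
    [/\ (a <= n)%N && (b <= m)%N, forall i, D (v i), forall j, D (w j)
      & presented v w M (representative x)].
Proof.
split=> [[X [tX [b0 [b1 [xE Xb [b0D b1D] b0n b1m]]]]]|].
  have [v [w [M [MX vb wb]]]] := betti_presented Xb.
  exists (betti_total b0), (betti_total b1), v, w, M; rewrite b0n b1m.
  split=> //.
  - by move=> i; exact: b0D.
  - by move=> j; exact: b1D.
  apply: isomorphic_presented MX.
  by apply/(class_ofP c tX (tame_representative x)); rewrite representativeK.
move=> [a [b [v [w [M [/andP[an bm] vD wD MX]]]]]].
have [b0 [b1 [Xb b0D b1D b0a b1b]]] := presented_betti vD wD MX.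
exists (representative x), (tame_representative x), b0, b1; split=> //.
- by rewrite representativeK.
- exact: leq_trans an.
- exact: leq_trans bm.
Qed.

End Reduction.

(** * Transporting elements along zig-zags *)

Section Distance.
Variables (R : realType) (l : nat) (c : contour R l) (K : fieldType).
Implicit Types (X Y : pfunctor R l K) (v w : orthant R l) (s t : {nonneg R}).

Lemma ple_oo_refl (p : option (orthant R l)) : ple_oo p p.
Proof. by case: p => //= v; exact: ple_refl. Qed.

Lemma ple_oo_trans (p q r : option (orthant R l)) :
  ple_oo q p -> ple_oo p r -> ple_oo q r.
Proof. by case: q p r => [v|] [w|] [u|] //=; exact: ple_trans. Qed.

Lemma ple_oo_some (p : option (orthant R l)) w :
  ple_oo p (Some w) -> exists2 u, p = Some u & ple u w.
Proof. by case: p => // u; exists u. Qed.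

Definition annihilates t X : Prop :=
  forall v w, c (Some v) t = Some w -> forall h : ple v w, mor X h = 0.

Lemma annihilates_mono s t X : s%:num <= t%:num ->
  annihilates s X -> annihilates t X.
Proof.
move=> st Xs v w vw h.
have := shift_mono c (ple_oo_refl (Some v)) st; rewrite vw.
move=> /ple_oo_some[u vu uw]; have /= vu' := shift_ge c (Some v) s.
rewrite vu in vu'; rewrite (mor_comp X vu' uw) (Xs _ _ vu).
by rewrite comp_lfun0r.
Qed.

Lemma norm_lt_annihilates t X :
  (contour_norm c X < t%:num%:E)%E -> annihilates t X.
Proof.
move=> /ereal_inf_lt[_ [s Xs <-]]; rewrite lte_fin => /ltW st.
exact: annihilates_mono st Xs.
Qed.

Lemma annihilates_norm_le t X :
  annihilates t X -> (contour_norm c X <= t%:num%:E)%E.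
Proof. by move=> Xt; apply: ereal_inf_lbound; exists t. Qed.

Lemma annihilates_ker t X Y (f : nattrans X Y) :
  annihilates t (ker_functor f) <->
  forall v w, c (Some v) t = Some w -> forall (h : ple v w) a,
    f v a = 0 -> mor X h a = 0.
Proof.
have kE v w (h : ple v w) a :
    vsval (mor (ker_functor f) h a) = mor X h (vsval a).
  exact: val_kmor.
split=> [ft v w vw h a fa|ft v w vw h].
  have aK : a \in lker (f v) by rewrite memv_ker fa.
  by rewrite -(vsprojK aK) -kE ft// zero_lfunE linear0.
apply/lfunP => a; apply/val_inj; rewrite [LHS]kE zero_lfunE linear0 ft//.
by apply/eqP; rewrite -memv_ker subvsP.
Qed.

Lemma annihilates_coker t X Y (f : nattrans X Y) :
  annihilates t (coker_functor f) <->
  forall v w, c (Some v) t = Some w -> forall (h : ple v w) b,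
    exists a, mor Y h b = f w a.
Proof.
have kE v w (h : ple v w) b :
  coker_pi f w (mor Y h b) = mor (coker_functor f) h (coker_pi f v b).
  exact: coker_pi_mor.
split=> [ft v w vw h b|ft v w vw h].
  have : mor Y h b \in lker (coker_pi f w).
    by rewrite memv_ker kE ft// zero_lfunE.
  by rewrite coker_pi_ker => /memv_imgP[a _ ->]; exists a.
apply/lfunP => p; rewrite zero_lfunE -[p]coker_pi_val -kE.
have [a ->] := ft _ _ vw h (vsval p).
by apply/eqP; rewrite -memv_ker coker_pi_ker memv_img ?memvf.
Qed.

Lemma adde_lt_split (x y : \bar R) t : (0 <= x)%E -> (0 <= y)%E ->
  (x + y < t%:num%:E)%E -> exists s1 s2 : {nonneg R},
    [/\ (x < s1%:num%:E)%E, (y < s2%:num%:E)%E & s1%:num + s2%:num = t%:num].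
Proof.
case: x y => [x||] [y||]//; rewrite ?lee_fin -?EFinD ?lte_fin => x0 y0 xyt.
pose d := (t%:num - x - y) / 2.
have d0 : 0 < d by rewrite divr_gt0// -addrA -opprD subr_gt0.
have xd : 0 <= x + d by rewrite addr_ge0// ltW.
have yd : 0 <= y + d by rewrite addr_ge0// ltW.
exists (NngNum xd), (NngNum yd); split; rewrite ?lte_fin /= ?ltrDl//.
by rewrite /d; field.
Qed.

(* A nonzero element is transported along the zig-zag, lifting it through the *)
(* maps pointing backwards at the cost of a shift by their cokernel norms; it *)
(* stays nonzero after a further shift by the remaining length.               *)
Lemma zigzag_shift X Y r t : zigzag c X Y r -> (r < t%:num%:E)%E ->
  forall v w, c (Some v) t = Some w -> forall (h : ple v w) a, mor X h a != 0 ->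
  exists u (b : Y u), ple u w /\ b != 0.
Proof.
move=> XY; elim: XY t => {X Y r} [X t _ v w _ h a ha|].
  exists v, a; split=> //; apply: contraNN ha => /eqP ->.
  by rewrite linear0.
move=> X W Z Y r f g tW tZ ZY IH t rt v w vw h a ha.
(* The budget t is split as s + s1 + s2: s to lift through [g], s1 for the rest of the zig-zag, s2
   for the kernel of [f]. *)
have [|||s [s' [gs rs' ss'E]]] := @adde_lt_split
    (contour_norm c (coker_functor g)) (r + contour_norm c (ker_functor f)) t.
- exact: norm_ge0.
- by rewrite adde_ge0 ?norm_ge0// (zigzag_ge0 ZY).
- apply: le_lt_trans rt.
  rewrite (addeC r) addeA (addeC (contour_norm c (coker_functor g))).
  by rewrite leeD2r// leeD// ?leeDl ?leeDr ?norm_ge0.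
have [||s1 [s2 [rs1 fs2 s12E]]] := adde_lt_split _ _ rs'.
- exact: zigzag_ge0 ZY.
- exact: norm_ge0.
have {}gs := (annihilates_coker _ _).1 (norm_lt_annihilates gs).
have {}fs2 := (annihilates_ker _ _).1 (norm_lt_annihilates fs2).
have : ple_oo (c (c (c (Some v) s) s1) s2) (Some w).
  apply: ple_oo_trans (shift_mono c (shift_shift c _ s s1) (lexx s2%:num)) _.
  apply: ple_oo_trans (shift_shift _ _ _ _) _.
  by rewrite -vw shift_mono ?ple_oo_refl//= -addrA s12E ss'E.
move=> /ple_oo_some[w2 w2E w2w].
have := shift_ge c (c (c (Some v) s) s1) s2; rewrite w2E.
move=> /ple_oo_some[w1 w1E w12].
have := shift_ge c (c (Some v) s) s1; rewrite w1E => /ple_oo_some[u uE uw1].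
have := shift_ge c (Some v) s; rewrite uE /= => vu.
rewrite uE in w1E w2E; rewrite w1E in w2E.
have [z gz] := gs _ _ uE vu (f v a).
(* If the lift [z] died at [w1], then [f] would kill the image of [a] there, and the shift by s2
   would kill it by [w2], hence at [w]. *)
have z0 : mor Z uw1 z != 0.
  apply: contraNneq ha => z0; have vw1 := ple_trans vu uw1.
  rewrite (mor_comp X (ple_trans vw1 w12) w2w) (mor_comp X vw1 w12) !comp_lfunE.
  rewrite (fs2 _ _ w2E) ?linear0//.
  rewrite -comp_lfunE natural comp_lfunE (mor_comp W vu uw1) comp_lfunE gz.
  by rewrite -comp_lfunE -natural comp_lfunE z0 linear0.
have [u' [b [u'w1 b0]]] := IH _ rs1 _ _ w1E uw1 z z0.
by exists u', b; split=> //; exact: ple_trans (ple_trans u'w1 w12) w2w.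
Qed.
End Distance.

(** * Distance between cokernels of the same matrix *)

Section Approximation.
Variables (R : realType) (l : nat) (c : contour R l) (K : fieldType).
Implicit Types (X Y : pfunctor R l K) (t : {nonneg R}).

Lemma representable_free (v : orthant R l) :
  exists q, is_free (fun _ : 'I_1 => v) (representable K v) q.
Proof.
exists (fun x => linfun (mulmxr (const_mx 1 : 'M[K]_(1, ple v x)))).
have qE x (s : 'rV[K]_1) i :
    (s *m const_mx 1 : 'rV_(ple v x)) ord0 i = s ord0 ord0.
  by rewrite mxE big_ord1 mxE mulr1.
split.
- exact: freesp_mono.
- move=> x p; exists (const_mx (\sum_j p ord0 j)).
    apply/freespP => i; rewrite mxE; apply: contra_neqT => vx.
    rewrite big1// => j _.
    by have := ltn_ord j; rewrite [X in (_ < nat_of_bool X)%N](negbTE vx).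
  rewrite lfunE; apply/rowP => i; rewrite qE mxE (bigD1 i)//= big1 ?addr0//.
  by move=> j /negP[]; apply/eqP; exact: ord_bool_inj.
- move=> x s sS; rewrite lfunE memv0.
  apply/eqP/eqP => [s0|->]; last exact: linear0.
  apply/rowP => i; rewrite ord1 mxE; apply: contra_eq s0 => si.
  have vx : ple v x by move/freespP: sS => /(_ _ si).
  apply/eqP => /rowP; rewrite /= => s0; move: si.
  have i0 : 'I_(ple v x) by rewrite vx; exact: ord0.
  by rewrite -(qE x _ i0) [X in X != _]s0 mxE eqxx.
- move=> x y h s sS; rewrite !lfunE; apply/rowP => i; rewrite [RHS]qE mxE.
  rewrite (eq_bigr (fun=> s ord0 ord0)) => [|j _]; last first.
    by rewrite [X in X * _]qE mxE mulr1.
  rewrite sumr_const card_ord.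
  have [->|si] := eqVneq (s ord0 ord0) 0; first by rewrite mul0rn.
  by move/freespP: sS => /(_ _ si) ->.
Qed.

Lemma is_free_tame a (v : 'I_a -> orthant R l) X q : is_free v X q -> tame X.
Proof.
move=> [q_mono q_surj q_ker q_mor].
apply: (@presented_tame _ _ _ a 0 v (fun=> origin R l) 0); split=> [[]//|].
exists q; split=> // x s sS; rewrite q_ker//.
rewrite memv0; apply/eqP/relspP => [->|[r _ ->]]; last exact: mulmx0.
by exists 0; rewrite ?mem0v ?mulmx0.
Qed.

Lemma tame_representable (v : orthant R l) : tame (representable K v).
Proof. by have [q /is_free_tame] := representable_free v. Qed.

(** If v*t is finite, the generator of K(v,-) survives there, so [zigzag_shift] yields a nonzero
    element of K(w,-) at some degree below v*t, and w lies below that degree. *)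
Lemma dN_representable_shift (v w : orthant R l) t :
  (dN c (representable K v) (representable K w) < t%:num%:E)%E ->
  ple_oo (Some w) (c (Some v) t).
Proof.
move=> /dN_lt[r vw rt].
case E: (c (Some v) t) => [u|//] /=.
have /= vu := shift_ge c (Some v) t; rewrite E in vu.
pose a : representable K v v := (const_mx 1 : 'rV[K]_(ple v v)).
have au : mor (representable K v) vu a != 0.
  have i : 'I_(ple v u) by rewrite vu; exact: ord0.
  rewrite lfunE /=; apply/eqP => /rowP/(_ i)/eqP.
  rewrite !mxE (eq_bigr (fun=> 1)) => [|j _]; last by rewrite !mxE mulr1.
  by rewrite sumr_const card_ord ple_refl oner_eq0.
have [u' [b [u'u b0]]] := zigzag_shift vw rt E au.
apply: ple_trans u'u; move: b b0 => /=; case: (ple w u') => // b /eqP[].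
by rewrite (thinmx0 b).
Qed.

Lemma continuous_contour_shift : continuous_contour c K ->
  forall v t, 0 < t%:num -> exists2 d : R, 0 < d & forall w, dist_oo v w < d ->
  ple_oo (Some w) (c (Some v) t) /\ ple_oo (Some v) (c (Some w) t).
Proof.
move=> c_cont v t t0; have [d d0 dP] := c_cont v _ t0.
exists d => // w /dP vw; split; apply: dN_representable_shift => //.
by rewrite dN_sym//; exact: tame_representable.
Qed.

Lemma ple_oo_shift_trans (v v' x y : orthant R l) t :
  ple_oo (Some v') (c (Some v) t) -> ple v x -> c (Some x) t = Some y ->
  ple v' y.
Proof.
move=> vv' vx xy; rewrite -/(ple_oo (Some v') (Some y)) -xy.
by apply: ple_oo_trans vv' _; exact: shift_mono.
Qed.

(** The identity of K^a induces the map, since everything present for the larger degrees is present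
    for the smaller ones. A shift by t reverses this: for relations it kills the kernel, for
    generators the cokernel, at cost t each. *)
Lemma presented_le_shift a b (v v' : 'I_a -> orthant R l)
    (w w' : 'I_b -> orthant R l) M X X' t :
  presented v w M X -> presented v' w' M X' ->
  (forall i, ple (v i) (v' i)) -> (forall j, ple (w j) (w' j)) ->
  (forall i, ple_oo (Some (v' i)) (c (Some (v i)) t)) ->
  (forall j, ple_oo (Some (w' j)) (c (Some (w j)) t)) ->
  exists f : nattrans X' X, (norm_mor c f <= (t%:num + t%:num)%:E)%E.
Proof.
move=> [Madm [q qX]] [M'adm [q' q'X]] vv' ww' v't w't.
have sub n (z z' : 'I_n -> orthant R l) (zz' : forall i, ple (z i) (z' i)) x s :
    s \in freesp z' x -> s \in freesp (K := K) z x.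
  move=> /freespP sS; apply/freespP => i /sS; exact: ple_trans.
have shift n (z z' : 'I_n -> orthant R l) x y s :
    (forall i, ple_oo (Some (z' i)) (c (Some (z i)) t)) ->
    c (Some x) t = Some y -> s \in freesp z x -> s \in freesp (K := K) z' y.
  move=> zt xy /freespP sS; apply/freespP => i /sS zx.
  exact: ple_oo_shift_trans (zt i) zx xy.
have [f fE] := quotient_map (L := \1%VF) q'X qX
  (fun x s => ltac:(by rewrite id_lfunE; exact: sub))
  (fun x s _ => ltac:(by rewrite id_lfunE => /relspP[r rS ->];
                         apply/relspP; exists r => //; exact: sub rS)).
have {}fE x s : s \in freesp v' x -> f x (q' x s) = q x s.
  by move=> sS; rewrite fE// id_lfunE.
have [_ q_surj q_ker q_mor] := qX; have [_ q'_surj q'_ker q'_mor] := q'X.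
exists f; rewrite EFinD leeD//; apply: annihilates_norm_le.
  apply/annihilates_ker => x y xy h p; have [s sS <-] := q'_surj x p.
  rewrite fE// => /eqP; rewrite q_ker; last exact: sub sS.
  move=> /relspP[r rS sE]; rewrite q'_mor//; apply/eqP; rewrite q'_ker.
    by apply/relspP; exists r => //; exact: shift xy rS.
  exact: (subvP (freesp_mono _ _ h)).
apply/annihilates_coker => x y xy h p; have [s sS <-] := q_surj x p.
by exists (q' y s); rewrite q_mor// fE// (shift _ _ _ _ _ _ v't xy).
Qed.

(** M stays admissible on the joined degrees, and its cokernel there maps to both X and X' with norm
    at most 2t each. *)
Lemma dN_presented_le a b (v v' : 'I_a -> orthant R l)
    (w w' : 'I_b -> orthant R l) M X X' t :
  presented v w M X -> presented v' w' M X' ->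
  (forall i, ple_oo (Some (v' i)) (c (Some (v i)) t)) ->
  (forall j, ple_oo (Some (w' j)) (c (Some (w j)) t)) ->
  (forall i, ple_oo (Some (v i)) (c (Some (v' i)) t)) ->
  (forall j, ple_oo (Some (w j)) (c (Some (w' j)) t)) ->
  (dN c X X' <= (t%:num *+ 4)%:E)%E.
Proof.
move=> MX MX' v't w't vt wt.
pose vj i := pjoin (v i) (v' i); pose wj j := pjoin (w j) (w' j).
have joint z z' : ple_oo (Some z') (c (Some z) t) ->
    ple_oo (Some (pjoin z z')) (c (Some z) t).
  have := shift_ge c (Some z) t; case: (c (Some z) t) => //= u.
  exact: pjoin_ple.
have joint' z z' : ple_oo (Some z) (c (Some z') t) ->
    ple_oo (Some (pjoin z z')) (c (Some z') t).
  have := shift_ge c (Some z') t; case: (c (Some z') t) => //= u.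
  by move=> ? ?; exact: pjoin_ple.
have Madm : admissible vj wj M.
  move=> j i Mji; apply: pjoin_ple.
    exact: ple_trans (MX.1 _ _ Mji) (ple_joinl _ _).
  exact: ple_trans (MX'.1 _ _ Mji) (ple_joinr _ _).
have [J MJ] := presented_exists Madm.
have [f fN] := presented_le_shift MX MJ (fun i => ple_joinl _ _)
  (fun j => ple_joinl _ _) (fun i => joint _ _ (v't i))
  (fun j => joint _ _ (w't j)).
have [f' f'N] := presented_le_shift MX' MJ (fun i => ple_joinr _ _)
  (fun j => ple_joinr _ _) (fun i => joint' _ _ (vt i))
  (fun j => joint' _ _ (wt j)).
have id_iso Y : is_iso (nat_id Y).
  by exists (nat_id Y) => x; rewrite comp_lfun1l.
have tX := presented_tame MX; have tX' := presented_tame MX'.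
have zz := zigzag_cons (nat_id X) f tX (presented_tame MJ)
  (zigzag_cons f' (nat_id X') tX' tX' (zigzag_nil c X')).
apply: le_trans (dN_le zz) _; rewrite !(norm_mor_iso c (id_iso _)) add0e !adde0.
apply: le_trans (leeD fN f'N) _; rewrite -EFinD lee_fin.
by rewrite -!mulr2n -mulrnA.
Qed.
End Approximation.

(** * Limits of degrees and compactness of T(D,n,m) *)

Section Compactness.
Variables (R : realType) (l : nat).

HB.instance Definition _ := isPointed.Build (orthant R l) (origin R l).

(** The image of an ultrafilter clusters in D, and a cluster point of an ultrafilter is a limit. *)
Lemma ultra_compact_cvg (T : Type) (U : set_system T) (S : topologicalType)
    (f : T -> S) (D : set S) :
  UltraFilter U -> compact D -> U (f @^-1` D) ->
  exists2 p, D p & f @ U --> p.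
Proof.
move=> UU cD UD; have [p [Dp clp]] := cD _ (fmap_proper_filter f _) UD.
exists p => // B Bp; have [//|UB] := in_ultra_setVsetC (f @^-1` B) UU.
by have [q [nB /nB]] := clp (~` B) B UB Bp.
Qed.

Lemma ball_dist_oo (v w : orthant R l) (d : R) : ball v d w -> dist_oo v w < d.
Proof.
rewrite -initial_ballE => -[d0 vw]; apply/bigmax_ltP; split => // i _.
exact: vw.
Qed.

Lemma near_dist_oo (T : Type) (U : set_system T) (f : T -> orthant R l) p d :
  Filter U -> f @ U --> p -> 0 < d -> \forall x \near U, dist_oo p (f x) < d.
Proof.
move=> FU fp d0.
have pd : \forall x \near U, ball p d (f x) by move/cvg_ballP: fp; apply.
by near do apply: ball_dist_oo.
Unshelve. all: by end_near. Qed.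

Lemma ple_cvg (T : Type) (U : set_system T) (f g : T -> orthant R l) p q :
  ProperFilter U -> f @ U --> p -> g @ U --> q ->
  (\forall x \near U, ple (f x) (g x)) -> ple p q.
Proof.
move=> PU fp gq fg; apply/forallP => i; rewrite leNgt; apply/negP => qp.
(* Half the gap: within d of p and q the i-th coordinates stay strictly reversed. *)
pose d := (pcoord p i - pcoord q i) / 2.
have d0 : 0 < d by rewrite divr_gt0// subr_gt0.
have dist_le (v w : orthant R l) : `|pcoord v i - pcoord w i| <= dist_oo v w.
  exact: (@le_bigmax _ _ _ _ _ i).
have [x [[fgx pfx] qgx]] :
    exists x, (ple (f x) (g x) /\ dist_oo p (f x) < d) /\ dist_oo q (g x) < d.
  apply: (@filter_ex _ U); apply: filterI; last exact: near_dist_oo.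
  by apply: filterI; last exact: near_dist_oo.
have := le_lt_trans (dist_le _ _) pfx; have := le_lt_trans (dist_le _ _) qgx.
move/forallP/(_ i): fgx; rewrite !ltr_norml /d.
by move=> fgi /andP[qgi _] /andP[_ pfi]; lra.
Qed.

Variables (c : contour R l) (K : finFieldType).

Definition presented_classes (D : set (orthant R l)) a b (M : 'M[K]_(b, a)) :
    set (iso_class K c) :=
  [set x | exists v w, [/\ forall i, D (v i), forall j, D (w j)
                         & presented v w M (representative x)]].

Lemma compact_presented_classes (D : set (orthant R l)) a b (M : 'M[K]_(b, a)) :
  continuous_contour c K -> compact D -> compact (presented_classes D M).
Proof.
move=> /continuous_contour_shift c_cont cD; rewrite compact_ultra => U UU UA.
(* Degrees are chosen for every class, with the origin as a dummy value outside the set, so that the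
   ultrafilter can be pushed forward to D coordinatewise. *)
have /choice[vw vwP] (x : iso_class K c) :
    exists vw : ('I_a -> orthant R l) * ('I_b -> orthant R l),
    presented_classes D M x -> [/\ forall i, D (vw.1 i), forall j, D (vw.2 j)
      & presented vw.1 vw.2 M (representative x)].
  have [[v [w vwP]]|nx] := pselect (presented_classes D M x).
    by exists (v, w).
  by exists (fun=> origin R l, fun=> origin R l).
pose v x := (vw x).1; pose w x := (vw x).2.
have /choice[p pP] i : exists p, D p /\ v ^~ i @ U --> p.
  have [|p Dp vp] := @ultra_compact_cvg _ U _ (v ^~ i) D UU cD.
    by apply: filterS UA => x /vwP[vD _ _]; exact: vD.
  by exists p.
have /choice[r rP] j : exists r, D r /\ w ^~ j @ U --> r.
  have [|r Dr wr] := @ultra_compact_cvg _ U _ (w ^~ j) D UU cD.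
    by apply: filterS UA => x /vwP[_ wD _]; exact: wD.
  by exists r.
have Madm : admissible p r M.
  move=> j i Mji; apply: (ple_cvg _ (pP i).2 (rP j).2).
  by apply: filterS UA => x /vwP[_ _ [Madm _]]; exact: Madm.
have [X MX] := presented_exists Madm; have tX := presented_tame MX.
pose y := iso_class_of c tX.
have My : presented p r M (representative y).
  apply: isomorphic_presented MX; apply: isomorphic_sym.
  by apply/(class_ofP c (tame_representative y) tX); exact: representativeK.
exists y; split.
  by exists p, r; split=> [i|j|]; [exact: (pP i).1|exact: (rP j).1|].
apply/cvg_ballP => e e0.
(* [dN_presented_le] costs 4t, so t = e / 8 gives e / 2, strictly below e. *)
have t0 : 0 <= e / 8 by rewrite divr_ge0 ?ltW.
pose t := NngNum t0.
have tpos : 0 < t%:num by rewrite divr_gt0.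
have shift_near (f : iso_class K c -> orthant R l) z : f @ U --> z ->
    \forall x \near U, ple_oo (Some (f x)) (c (Some z) t) /\
                       ple_oo (Some z) (c (Some (f x)) t).
  move=> fz; have [d d0 dP] := c_cont z t tpos.
  by apply: filterS (near_dist_oo _ fz d0) => x; exact: dP.
have v_near : \forall x \near U, forall i,
    ple_oo (Some (v x i)) (c (Some (p i)) t) /\
    ple_oo (Some (p i)) (c (Some (v x i)) t).
  by apply: filter_forall => i; exact: shift_near (pP i).2.
have w_near : \forall x \near U, forall j,
    ple_oo (Some (w x j)) (c (Some (r j)) t) /\
    ple_oo (Some (r j)) (c (Some (w x j)) t).
  by apply: filter_forall => j; exact: shift_near (rP j).2.
apply: filterS (filterI UA (filterI v_near w_near)) => x [/vwP[_ _ Mx] [vx wx]].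
have yx := dN_presented_le My Mx (fun i => (vx i).1) (fun j => (wx j).1)
  (fun i => (vx i).2) (fun j => (wx j).2).
apply: le_lt_trans yx _; rewrite lte_fin /=; lra.
Qed.

Lemma fin_bigcup_compact (S : topologicalType) (I : finType) (F : I -> set S) :
  (forall i, compact (F i)) -> compact (\bigcup_i F i).
Proof.
move=> cF; suff -> : \bigcup_i F i = \big[setU/set0]_(i <- enum I) F i.
  exact: bigsetU_compact.
rewrite -bigcup_seq; congr bigcup; apply/seteqP; split=> i //= _.
by rewrite mem_enum.
Qed.

Lemma compact_bounded_betti (D : set (orthant R l)) n m :
  continuous_contour c K -> compact D -> compact (bounded_betti c K D n m).
Proof.
move=> c_cont cD.
(* The union over matrices is finite because K is. *)
suff -> : bounded_betti c K D n m = \bigcup_(a : 'I_n.+1) \bigcup_(b : 'I_m.+1)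
    \bigcup_(M : 'M[K]_(b, a)) presented_classes D M.
  do 3 (apply: fin_bigcup_compact => ?).
  exact: compact_presented_classes.
apply/seteqP; split=> x.
  move=> /bounded_bettiP[a [b [v [w [M [/andP[an bm] vD wD MX]]]]]].
  exists (Ordinal (an : (a < n.+1)%N)) => //.
  exists (Ordinal (bm : (b < m.+1)%N)) => //.
  by exists M => //; exists v, w.
move=> [a _ [b _ [M _ [v [w [vD wD MX]]]]]]; apply/bounded_bettiP.
by exists a, b, v, w, M; split=> //; rewrite -ltnS ltn_ord -ltnS ltn_ord.
Qed.

Lemma tame_zero : tame (@zero_functor R l K).
Proof. by have [q /is_free_tame] := free_seqP K (origin R l) [::]. Qed.

HB.instance Definition _ :=
  isPointed.Build (iso_class K c) (iso_class_of c tame_zero).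

End Compactness.

(** * Completeness and total boundedness from compactness *)

Lemma compact_complete (R : realType) (T : pseudoMetricType R) (A : set T) :
  compact A -> complete_set A.
Proof.
move=> cA u uA /cauchy_ballP u_cauchy.
have u_near : \forall k \near \oo, A (u k) by exact: nearW.
(* A cluster point of a Cauchy sequence is a limit of it. *)
have [x [Ax xu]] := cA _ (fmap_proper_filter u _) u_near.
exists x => //; apply/cvg_ballP => e e0.
have e2 : 0 < e / 2 by rewrite divr_gt0.
have [[B1 B2] /= [uB1 uB2] B12] := u_cauchy _ e2.
have [y [B1y xy]] := xu B1 _ uB1 (nbhsx_ballx x _ e2).
apply: filterS uB2 => z B2z; apply: ball_split xy _.
exact: (B12 (y, z)).
Qed.

Lemma cover_compact_totally_bounded (R : realType) (T : pseudoMetricType R)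
    (A : set T) :
  cover_compact A -> totally_bounded_set A.
Proof.
move=> cA e e0.
(* Balls are replaced by their interiors to obtain an open cover, indexed by its centres in A. *)
have [||F FA AF] := cA T A (fun x => (ball x e)^°) .
- by move=> x _; exact: open_interior.
- by move=> x Ax; exists x => //; exact: nbhsx_ballx.
exists [set` F]; split.
- exact: finite_fset.
- by move=> x /FA; rewrite inE.
- by move=> x /AF[y yF /interior_subset xy]; exists y.
Qed.

Theorem theorem10p5 (R : realType) (l : nat) (c : contour R l)
    (K : finFieldType) (D : set (orthant R l)) (n m : nat)
    (D_compact : cover_compact D) (n_pos : (0 < n)%N) (m_pos : (0 < m)%N) :
  (continuous_contour c K ->
     cover_compact (bounded_betti c K D n m)) /\
  (continuous_contour c K -> unital c ->
     [/\ cover_compact (bounded_betti c K D n m),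
         complete_set (bounded_betti c K D n m) &
         totally_bounded_set (bounded_betti c K D n m)]).
Proof.
have cD : compact D by rewrite compact_cover.
have compactT : continuous_contour c K -> compact (bounded_betti c K D n m).
  by move=> c_cont; exact: compact_bounded_betti.
have coverT : continuous_contour c K -> cover_compact (bounded_betti c K D n m).
  by move=> /compactT; rewrite compact_cover.
split=> // c_cont _; split; first exact: coverT.
  exact/compact_complete/compactT.
exact/cover_compact_totally_bounded/coverT.
Qed.
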